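(* Let $T(G;x,y)$ be the Tutte polynomial of a graph $G$. If $G$ has no loops, then, as polynomials in $t$, $$T(G;t,0)=\bar\tau(G,t-1)=(-1)^{r(G)}\tau(G,1-t).$$ Moreover, $T(G;1,0)=(-1)^{r(G)}\tau(G,0)=\bar\tau(G,0)$ is the number of cut-equivalence classes of acyclic orientations of $G$.
   Context: Graphs $G=(V,E)$ are finite, possibly with multiple edges. $r(G)=|V|-k(G)$, where $k(G)$ is the number of connected components. The Tutte polynomial is $T(G;x,y)=\sum_{A\subseteq E}(x-1)^{r\langle E\rangle-r\langle A\rangle}(y-1)^{n\langle A\rangle}$, where $\langle A\rangle=(V,A)$, $r\langle A\rangle=|V|-k(\langle A\rangle)$ and $n\langle A\rangle=|A|-r\langle A\rangle$. An orientation $\varepsilon$ of $G$ assigns an arrow $\varepsilon(x)$ to each edge $x$ (two choices for an edge with two distinct endpoints). $\mathcal O(G)$ is the set of orientations of $G$. A circuit is a connected subgraph with degree 2 at every vertex (two parallel edges form a circuit); a direction of a circuit $C$ is an orientation $\varepsilon_C$ of $C$ with one arrow in and one arrow out at every vertex. An orientation $\varepsilon$ is acyclic if there is no circuit $C$ on which the restriction of $\varepsilon$ is a direction of $C$. $A\mathcal O(G)$ is the set of acyclic orientations. For orientations $\varepsilon_i$ of subgraphs $H_i$ of $G$, the coupling $[\varepsilon_1,\varepsilon_2]:E\to\mathbb Z$ is $1$ at $x\in E(H_1)\cap E(H_2)$ if $\varepsilon_1(x)=\varepsilon_2(x)$, $-1$ at $x\in E(H_1)\cap E(H_2)$ if $\varepsilon_1(x)\ne\varepsilon_2(x)$,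 and $0$ otherwise. For an abelian group $A$, a tension of $(G,\varepsilon)$ with values in $A$ is $f:E\to A$ with $\sum_{x\in C}[\varepsilon,\varepsilon_C](x)f(x)=0$ for every circuit $C$ with direction $\varepsilon_C$; $T(G,\varepsilon;A)$ is the group of such tensions. For a positive integer $q$, $\tau(G,q)$ is the number of nowhere-zero tensions ($f(x)\ne0$ for all $x\in E$) of $(G,\varepsilon)$ with values in an abelian group of order $q$; it is independent of $\varepsilon$ and of the group, and is a polynomial function of $q$, whose polynomial is denoted $\tau(G,t)$. Cuts: for a partition $\{S,T\}$ of $V$, the cut $[S,T]$ is the set of all edges between $S$ and $T$. A cut $[S,T]$ is directed with respect to $\varepsilon$ if all its edges have arrows from $S$ to $T$ or all have arrows from $T$ to $S$; a directed bond is a minimal (nonempty) directed cut. A cut is oriented (with respect to $\varepsilon$) if it is a disjoint union of directed bonds. Orientations $\varepsilon,\varrho$ are cut-equivalent if $\{x\in E:\varepsilon(x)\ne\varrho(x)\}$ is empty or is an oriented cut with respect to either $\varepsilon$ or $\varrho$. This is an equivalence relation on $\mathcal O(G)$, and any orientation cut-equivalent to an acyclic one is acyclic; $[A\mathcal O(G)]$ is the set of cut-equivalence classes of acyclic orientations. For a positive integer $q$, $$\bar\tau(G,q)=\#\{([\varepsilon],f):[\varepsilon]\in[A\mathcal O(G)],\ f\in T(G,\varepsilon;\mathbb Z),\ 0\le f(x)\le q\ \forall x\in E\},$$ with one fixed representative $\varepsilon$ for each class (the count does not depend on the choice); it is a polynomial function of $q$, whose polynomial is denoted $\bar\tau(G,t)$.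 *)

(* Defs.v *)
From Stdlib Require Import ClassicalEpsilon.
From HB Require Import structures.
From mathcomp Require Import all_boot all_order all_algebra.

Set Implicit Arguments.
Unset Strict Implicit.
Unset Printing Implicit Defensive.

Import GRing.Theory.
Local Open Scope ring_scope.

(* Multiple edges are allowed, and a loop is an edge with a single end. *)
Record graph := Graph {
  vert : finType;
  edge : finType;
  ends : edge -> {set vert};
  ends_card : forall x, (0 < #|ends x| <= 2)%N
}.

Definition is_loop (G : graph) (x : edge G) : bool := #|ends x| == 1%N.

Definition loopless (G : graph) : Prop := forall x : edge G, ~~ is_loop x.

Definition adj (G : graph) (A : {set edge G}) : rel (vert G) :=
  fun u v => [exists x in A, ends x == [set u; v]].

(* The number k<A> of connected components of (V, A). *)
Definition ncomp (G : graph) (A : {set edge G}) : nat :=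
  n_comp (adj A) predT.

Definition rk (G : graph) (A : {set edge G}) : nat :=
  (#|vert G| - ncomp A)%N.

Definition nullity (G : graph) (A : {set edge G}) : nat :=
  (#|A| - rk A)%N.

Definition rkG (G : graph) : nat := rk [set: edge G].

(* As in polyXY, the first variable x is the outer 'X and the second variable
   y is 'Y = 'X%:P.  The truncated subtractions in the exponents are exact,
   since rk A <= rkG G and rk A <= #|A|. *)
Definition tutte (G : graph) : {poly {poly rat}} :=
  \sum_(A : {set edge G})
    ('X - 1) ^+ (rkG G - rk A) * ('Y - 1) ^+ nullity A.

(* An arrow on an edge is the pair (tail, head).  A loop has only one arrow. *)
Definition arrows (G : graph) := {ffun edge G -> vert G * vert G}.

(* e is an orientation of the subgraph with edge set F; the values of e
   outside F are irrelevant. *)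
Definition orients (G : graph) (F : {set edge G}) (e : arrows G) : bool :=
  [forall x in F, [set (e x).1; (e x).2] == ends x].

Definition orientations (G : graph) : {set arrows G} :=
  [set e | orients [set: edge G] e].

Definition deg (G : graph) (F : {set edge G}) (v : vert G) : nat :=
  (#|[set x in F | v \in ends x]| + #|[set x in F | ends x == [set v]]|)%N.

Definition subgraph (G : graph) (W : {set vert G}) (F : {set edge G}) : bool :=
  [forall x in F, ends x \subset W].

Definition connected_subgraph (G : graph)
    (W : {set vert G}) (F : {set edge G}) : bool :=
  [&& subgraph W F, W != set0 &
      [forall u in W, forall v in W, connect (adj F) u v]].

Definition circuit (G : graph) (W : {set vert G}) (F : {set edge G}) : bool :=
  connected_subgraph W F && [forall v in W, deg F v == 2%N].

Definition is_direction (G : graph)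
    (W : {set vert G}) (F : {set edge G}) (e : arrows G) : bool :=
  orients F e &&
  [forall v in W, (#|[set x in F | (e x).1 == v]| == 1%N) &&
                  (#|[set x in F | (e x).2 == v]| == 1%N)].

Definition acyclic (G : graph) (e : arrows G) : bool :=
  ~~ [exists W : {set vert G}, exists F : {set edge G},
        circuit W F && is_direction W F e].

Definition acyclic_orientations (G : graph) : {set arrows G} :=
  [set e in orientations G | acyclic e].

Definition coupling (G : graph) (F1 : {set edge G}) (e1 : arrows G)
    (F2 : {set edge G}) (e2 : arrows G) (x : edge G) : int :=
  if x \in F1 :&: F2 then (if e1 x == e2 x then 1 else -1) else 0.

Definition is_tension (G : graph) (A : zmodType) (e : arrows G)
    (f : edge G -> A) : bool :=
  [forall W : {set vert G}, forall F : {set edge G}, forall eC : arrows G,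
     circuit W F && is_direction W F eC ==>
     (\sum_(x in F) f x *~ coupling [set: edge G] e F eC x == 0)].

Definition nz_tensions (G : graph) (A : finZmodType) (e : arrows G) :
    {set {ffun edge G -> A}} :=
  [set f : {ffun edge G -> A} | is_tension e f & [forall x, f x != 0]].

(* P is the polynomial tau(G, t), for all reference orientations and all
   finite abelian groups of values at once. *)
Definition is_tau_poly (G : graph) (P : {poly rat}) : Prop :=
  forall (A : finZmodType) (e : arrows G), e \in orientations G ->
    P.[#|A|%:R] = #|nz_tensions A e|%:R.

(* Such a polynomial is unique, its values at all positive integers being
   prescribed. *)
Definition tau (G : graph) : {poly rat} :=
  epsilon (inhabits 0) (is_tau_poly G).

Definition cut (G : graph) (S : {set vert G}) : {set edge G} :=
  [set x | (ends x :&: S != set0) && (ends x :&: ~: S != set0)].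

Definition is_cut (G : graph) (D : {set edge G}) : bool :=
  [exists S : {set vert G}, [&& S != set0, ~: S != set0 & D == cut S]].

Definition directed_cut (G : graph) (e : arrows G) (D : {set edge G}) : bool :=
  [exists S : {set vert G},
    [&& S != set0, ~: S != set0, D == cut S &
        [forall x in D, ((e x).1 \in S) && ((e x).2 \in ~: S)] ||
        [forall x in D, ((e x).1 \in ~: S) && ((e x).2 \in S)]]].

Definition directed_bond (G : graph) (e : arrows G) (D : {set edge G}) : bool :=
  minset (fun B => (B != set0) && directed_cut e B) D.

Definition oriented_cut (G : graph) (e : arrows G) (D : {set edge G}) : bool :=
  is_cut D &&
  [exists P : {set {set edge G}},
     partition P D && [forall B in P, directed_bond e B]].

Definition cut_equiv (G : graph) : rel (arrows G) := fun e r =>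
  let D := [set x | e x != r x] in
  [|| D == set0, oriented_cut e D | oriented_cut r D].

Definition acyclic_classes (G : graph) : {set {set arrows G}} :=
  equivalence_partition (@cut_equiv G) (acyclic_orientations G).

(* The pairs ([e], f), where rep chooses a representative of each class and
   an integer-valued f with 0 <= f x <= q is given as a map to 'I_q.+1. *)
Definition bounded_tensions (G : graph) (rep : {set arrows G} -> arrows G)
    (q : nat) : {set {set arrows G} * {ffun edge G -> 'I_q.+1}} :=
  [set p : {set arrows G} * {ffun edge G -> 'I_q.+1} |
           (p.1 \in acyclic_classes G) &&
           is_tension (rep p.1) (fun x => (p.2 x : nat)%:Z)].

(* P is the polynomial bar-tau(G, t), for all choices of representatives. *)
Definition is_taubar_poly (G : graph) (P : {poly rat}) : Prop :=
  forall rep : {set arrows G} -> arrows G,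
    (forall c, c \in acyclic_classes G -> rep c \in c) ->
  forall q : nat, (0 < q)%N -> P.[q%:R] = #|bounded_tensions rep q|%:R.

Definition taubar (G : graph) : {poly rat} :=
  epsilon (inhabits 0) (is_taubar_poly G).

(* Main.v *)
Require Import Defs.
From mathcomp Require Import all_boot all_order all_algebra.
From mathcomp Require Import zify.

Set Implicit Arguments.
Unset Strict Implicit.
Unset Printing Implicit Defensive.

Import Order.TTheory GRing.Theory Num.Theory.
Local Open Scope ring_scope.

(** Tensions are coboundaries of vertex potentials.  For tau, counting the
    potentials without monochromatic edges by inclusion-exclusion gives
    [tau(q) = sum_B (-1)^|B| q^(r(E) - r(B))], which becomes [T(t, 0)] up to sign
    at [q = 1 - t].

    For bar-tau, two orientations are cut-equivalent exactly when the indicator of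
    the edges on which they differ is the coboundary of an integer potential.
    Reducing integer tensions modulo q then turns the pairs ([e], f) together with
    a Z/q-valued potential of f into the pairs (p, e), where [p : V -> {0..q-1}]
    and e is an acyclic orientation along which p is weakly increasing.  For fixed
    p these are the acyclic orientations of the graph of the edges on which p is
    constant; deletion-contraction counts them as the sum of [(-1)^n(B)] over all
    sets B of such edges.

    At [q = 0], every class contains exactly one orientation in which each vertex
    is reachable from the chosen root of its component, and the same
    deletion-contraction argument counts these. *)

(** * Orientations, reversals and directed circuits *)

Definition swap (T : Type) (a : T * T) : T * T := (a.2, a.1).

Definition flip (G : graph) (e : arrows G) (D : {set edge G}) : arrows G :=
  [ffun x => if x \in D then swap (e x) else e x].

Definition diff (G : graph) (e r : arrows G) : {set edge G} :=
  [set x | e x != r x].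

Definition cobd (G : graph) (A : zmodType) (e : arrows G) (p : vert G -> A)
    (x : edge G) : A :=
  p (e x).2 - p (e x).1.

Definition arc (G : graph) (e : arrows G) : rel (vert G) :=
  fun u v => [exists x, e x == (u, v)].

Section Orientations.
Variable G : graph.
Implicit Types (e r : arrows G) (x : edge G) (D F : {set edge G}).

Lemma orientationP e :
  reflect (forall x, [set (e x).1; (e x).2] = ends x) (e \in orientations G).
Proof.
rewrite inE; apply: (iffP forall_inP) => H x; first by move/(_ x): H; rewrite inE => /(_ isT)/eqP.
by rewrite H.
Qed.

Lemma orientation_exists : exists e, e \in orientations G.
Proof.
have H x : exists a : vert G * vert G, [set a.1; a.2] == ends x.
  have /andP[H1] := ends_card x; rewrite leq_eqVlt => /orP[/eqP/eqP|H2].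
    by move=> /cards2P[a [b [_ ->]]]; exists (a, b).
  have /eqP : #|ends x| == 1%N by rewrite eqn_leq H1 andbT.
  by move/eqP/cards1P => [a ->]; exists (a, a); rewrite /= setUid.
exists [ffun x => xchoose (H x)]; apply/orientationP => x.
by rewrite ffunE (eqP (xchooseP (H x))).
Qed.

Lemma set2_eq (T : finType) (a b c d : T) :
  [set a; b] = [set c; d] -> (a, b) = (c, d) \/ (a, b) = (d, c).
Proof.
move=> H; have M z : (z \in [set a; b]) = (z \in [set c; d]) by rewrite H.
have := M a; have := M b; have := M c; have := M d.
rewrite !inE !eqxx ?orbT /=.
move=> /orP Hd /orP Hc /esym/orP Hb /esym/orP Ha.
by case: Ha => /eqP ?; case: Hb => /eqP ?; subst; auto; case: Hc => /eqP ?;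
  case: Hd => /eqP ?; subst; auto.
Qed.

Lemma adjP (F : {set edge G}) u v :
  reflect (exists2 x, x \in F & ends x = [set u; v]) (adj F u v).
Proof.
by apply: (iffP exists_inP) => -[x xF /eqP H]; exists x => //; apply/eqP.
Qed.

Lemma adj_sym F : symmetric (adj F).
Proof. by move=> u v; apply/adjP/adjP => -[x xF H]; exists x => //; rewrite setUC. Qed.

Lemma connect_adj_sym F : connect_sym (adj F).
Proof. exact/sym_connect_sym/adj_sym. Qed.

Lemma sub_adj F F' : F \subset F' -> subrel (connect (adj F)) (connect (adj F')).
Proof.
move=> /subsetP s; apply: connect_sub => u v /adjP[x xF Ex].
by apply: connect1; apply/adjP; exists x => //; apply: s.
Qed.

Hypothesis Gl : loopless G.

Lemma loopless_neq e x : e \in orientations G -> (e x).1 != (e x).2.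
Proof.
move=> /orientationP/(_ x) H; have := Gl x; rewrite /is_loop -H.
by rewrite cards2; have [] := eqVneq (e x).1 (e x).2.
Qed.

Lemma orientations_eqVswap e r x :
  e \in orientations G -> r \in orientations G -> r x != e x -> r x = swap (e x).
Proof.
move=> /orientationP/(_ x) He /orientationP/(_ x) Hr.
move: He Hr; case: (e x) (r x) => [a b] [c d] /= <- /set2_eq[->|->//].
by rewrite eqxx.
Qed.

Lemma swap_neq e x : e \in orientations G -> swap (e x) != e x.
Proof.
move=> /(loopless_neq x); case: (e x) => a b /=.
by rewrite /swap xpair_eqE /= negb_and eq_sym => ->.
Qed.

Lemma flip_orientation e D : e \in orientations G -> flip e D \in orientations G.
Proof.
move=> /orientationP H; apply/orientationP => x; rewrite ffunE -H.
by case: ifP => // _; rewrite /= setUC.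
Qed.

Lemma diff_flip e D : e \in orientations G -> diff e (flip e D) = D.
Proof.
move=> He; apply/setP => x; rewrite inE ffunE.
by case: ifP => _; [rewrite eq_sym swap_neq | rewrite eqxx].
Qed.

Lemma flip_diff e r :
  e \in orientations G -> r \in orientations G -> flip e (diff e r) = r.
Proof.
move=> He Hr; apply/ffunP => x; rewrite ffunE inE eq_sym.
by case: eqP => [//|/eqP H] /=; rewrite (orientations_eqVswap He Hr H).
Qed.

Lemma cobd_flip (A : zmodType) e D (p : vert G -> A) x :
  cobd (flip e D) p x = if x \in D then - cobd e p x else cobd e p x.
Proof. by rewrite /cobd ffunE; case: ifP => //= _; rewrite opprB. Qed.

Lemma cobd_orient (A : zmodType) e r (p : vert G -> A) x :
  e \in orientations G -> r \in orientations G ->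
  cobd r p x = if e x != r x then - cobd e p x else cobd e p x.
Proof. by move=> He Hr; rewrite -{1}(flip_diff He Hr) cobd_flip inE. Qed.

Lemma cobdB (A : zmodType) e (p s : vert G -> A) x :
  cobd e (fun v => p v - s v) x = cobd e p x - cobd e s x.
Proof. by rewrite /cobd opprD addrACA -opprD. Qed.

Lemma adj_orient e F u v : e \in orientations G ->
  reflect (exists2 x, x \in F & e x = (u, v) \/ e x = (v, u)) (adj F u v).
Proof.
move=> /orientationP H; apply: (iffP (adjP F u v)) => -[x xF Hx]; exists x => //.
  by move: Hx; rewrite -H => /set2_eq; rewrite -surjective_pairing.
by rewrite -H; case: Hx => -> //=; rewrite setUC.
Qed.

(** Without loops the two ends of an arrow are distinct, so the edges of [F] at [v] split into the
    one leaving [v] and the one entering it. *)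
Lemma direction_deg W F e v : e \in orientations G ->
  is_direction W F e -> v \in W -> deg F v = 2%N.
Proof.
move=> He /andP[_ /forall_inP H] /H /andP[/eqP H1 /eqP H2].
rewrite /deg.
have -> : [set x in F | ends x == [set v]] = set0.
  apply/setP => x; rewrite !inE; apply/negbTE/negP => /andP[_ /eqP E].
  by have := Gl x; rewrite /is_loop E cards1.
rewrite cards0 addn0 -[RHS]/(1 + 1)%N -{1}H1 -H2.
rewrite -cardsUI [X in (_ + X)%N](_ : _ = 0%N) ?addn0.
  apply: eq_card => x; rewrite !inE -(orientationP _ He x) !inE -andb_orr.
  by rewrite !(eq_sym v).
apply/eqP; rewrite cards_eq0; apply/eqP/setP => x; rewrite !inE.
apply/negbTE/negP => /andP[/andP[_ /eqP a] /andP[_ /eqP b]].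
by have := loopless_neq x He; rewrite a b eqxx.
Qed.

(** The arrow of [x] closes the simple directed path from its head back to its tail; choosing one
    edge for each pair of consecutive vertices gives the circuit. *)
Lemma directed_circuit e F x p : e \in orientations G ->
  path (fun a b => [exists y in F, e y == (a, b)]) (e x).2 p ->
  last (e x).2 p = (e x).1 -> uniq ((e x).2 :: p) ->
  exists W C, [/\ circuit W C, is_direction W C e, x \in C & C \subset x |: F].
Proof.
move=> He pP lp up; set c := (e x).2 :: p in up.
have xc : (e x).1 \in c by rewrite -lp mem_last.
have cyc : cycle (fun a b => [exists y in x |: F, e y == (a, b)]) c.
  rewrite /c /= rcons_path lp; apply/andP; split.
    apply: sub_path pP => a b /exists_inP[y yF E]; apply/exists_inP; exists y => //.
    by rewrite inE yF orbT.
  by apply/exists_inP; exists x; rewrite ?inE ?eqxx -?surjective_pairing.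
have nx : next c (e x).1 = (e x).2.
  have := next_prev up (e x).2.
  suff -> : prev c (e x).2 = (e x).1 by [].
  rewrite -lp /c /prev; have /= /andP[] := up; set z := (e x).2.
  move: {4 5}z => y; elim: (p) y => [y|b q IH y] /=; first by rewrite eqxx.
  by rewrite inE negb_or => /andP[/negbTE -> nq] /andP[_ uq]; apply: IH.
have hc : (e x).2 \in c by rewrite mem_head.
clearbody c.
(* [g a] is the edge by which the circuit leaves [a]. At the tail of [x] it is set to [x] itself,
   since a parallel edge could be picked there. *)
pose g a := if a == (e x).1 then x else
  odflt x [pick y in x |: F | e y == (a, next c a)].
have gP a : a \in c -> (g a \in x |: F) /\ e (g a) = (a, next c a).
  move=> ac; rewrite /g; case: eqP => [->|_].
    by rewrite !inE eqxx nx -surjective_pairing.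
  case: pickP => [y /andP[yF /eqP E] //|/= H].
  have /exists_inP[y yF E] := next_cycle cyc ac.
  by have := H y; rewrite yF E.
pose C := [set g a | a in c].
have CP y : y \in C -> exists2 a, a \in c & y = g a by move/imsetP.
have dir : is_direction [set a in c] C e.
  apply/andP; split; first by apply/forall_inP => y _; rewrite (orientationP _ He).
  apply/forall_inP => v; rewrite inE => vc; apply/andP; split.
    apply/cards1P; exists (g v); apply/setP => y; rewrite !inE.
    apply/andP/eqP => [[/CP[a ac ->]]|->]; last by rewrite imset_f // (gP v vc).2.
    by rewrite (gP a ac).2 /= => /eqP ->.
  have pc : prev c v \in c by rewrite mem_prev.
  apply/cards1P; exists (g (prev c v)); apply/setP => y; rewrite !inE.
  apply/andP/eqP => [[/CP[a ac ->]]|->].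
    by rewrite (gP a ac).2 /= => /eqP <-; rewrite (prev_next up).
  by rewrite imset_f // (gP _ pc).2 /= (next_prev up).
exists [set a in c], C; split=> //.
- apply/andP; split; last by apply/forall_inP => v vW; apply/eqP/(direction_deg He dir).
  apply/and3P; split.
  + apply/forall_inP => y /CP[a ac ->]; rewrite -(orientationP _ He) (gP a ac).2 /=.
    by apply/subsetP => z; rewrite !inE => /orP[]/eqP ->; rewrite ?mem_next.
  + by apply/set0Pn; exists (e x).2; rewrite inE.
  + apply/forall_inP => u uc; apply/forall_inP => v vc.
    rewrite !inE in uc vc; apply: (@connect_cycle _ _ c) => //.
    apply: (@sub_in_cycle _ (mem c) (frel (next c))) (cycle_next up); last exact/allP.
    move=> a b ac _ /eqP <-; apply/(adj_orient _ _ _ He).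
    by exists (g a); [exact: imset_f | left; exact: (gP a ac).2].
- by apply/imsetP; exists (e x).1 => //; rewrite /g eqxx.
- by apply/subsetP => y /CP[a /gP[H _] ->].
Qed.

(** Every vertex of [W] is the head of one edge of [F] and the tail of one, so heads and tails both
    contribute the sum of [p] over [W]. *)
Lemma direction_sum (A : zmodType) W F e (p : vert G -> A) :
  subgraph W F -> is_direction W F e -> \sum_(x in F) cobd e p x = 0.
Proof.
move=> /forall_inP sub /andP[/forall_inP orF /forall_inP dir].
have mem x : x \in F -> (e x).1 \in W /\ (e x).2 \in W.
  move=> xF; have /subsetP := sub x xF; rewrite -(eqP (orF x xF)) => s.
  by split; apply: s; rewrite !inE eqxx ?orbT.
have aux (f : edge G -> vert G) : (forall x, x \in F -> f x \in W) ->
    (forall v, v \in W -> #|[set x in F | f x == v]| = 1%N) ->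
    \sum_(x in F) p (f x) = \sum_(v in W) p v.
  move=> fW f1; rewrite (partition_big f (fun v => v \in W)) //=.
  apply: eq_bigr => v vW; rewrite (eq_bigr (fun _ => p v)); last by move=> x /andP[_ /eqP->].
  have := f1 v vW; rewrite -sum1dep_card => H.
  by rewrite sumr_const -[#|_|]sum1_card H.
rewrite sumrB !aux ?subrr // => [x /mem[]//|v /dir/andP[/eqP//]|x /mem[]//|v /dir/andP[_ /eqP//]].
Qed.

Lemma acyclicP e : e \in orientations G ->
  reflect (forall x, ~~ connect (arc e) (e x).2 (e x).1) (acyclic e).
Proof.
move=> He; apply: (iffP negP) => H.
  move=> x; apply/negP => /connectP[p0 /shortenP[p pP up _] lp]; apply: H.
  have [|W [C [c d _ _]]] := @directed_circuit e setT x p He _ (esym lp) up.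
    by apply: sub_path pP => a b /existsP[y E]; apply/exists_inP; exists y; rewrite ?inE.
  by apply/existsP; exists W; apply/existsP; exists C; rewrite c d.
case/existsP => W /existsP[F /andP[/andP[/and3P[sub /set0Pn[v vW] _] _] dir]].
have /andP[_ /forall_inP/(_ v vW)/andP[/cards1P[x E] _]] := dir.
have xF : x \in F by have := set11 x; rewrite -E inE => /andP[].
(* The indicator of the vertices reachable from the head of [x] never decreases along an arrow and
   increases along [x], so its coboundary cannot sum to zero over a directed circuit through [x]. *)
pose p u := (connect (arc e) (e x).2 u)%:R : int.
have := direction_sum p sub dir; rewrite (bigD1 x) //= /cobd {1 2}/p connect0 (negbTE (H x)).
apply/eqP; rewrite gt_eqF //; apply: ltr_pwDl; first by [].
apply: sumr_ge0 => y _; rewrite /p; case E1: (connect _ _ (e y).1); last by case: connect.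
suff -> : connect (arc e) (e x).2 (e y).2 by [].
apply: connect_trans E1 _; apply: connect1; apply/existsP; exists y.
by rewrite -surjective_pairing.
Qed.

End Orientations.

(** * Tensions as coboundaries *)

Section Tensions.
Variable G : graph.
Hypothesis Gl : loopless G.
Implicit Types (e r : arrows G) (x : edge G) (F : {set edge G}).

Lemma cobd_coupling (A : zmodType) e F eC (p : vert G -> A) x :
  e \in orientations G -> orients F eC -> x \in F ->
  cobd e p x *~ coupling [set: edge G] e F eC x = cobd eC p x.
Proof.
move=> He /forall_inP/(_ x) o xF; move/(_ xF)/eqP: o; rewrite -(orientationP _ He).
rewrite /coupling inE xF inE /=; case: eqP => [E _|ne]; first by rewrite /cobd E.
move=> /set2_eq; rewrite -!surjective_pairing => -[] E; first by case: ne.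
by rewrite /cobd; case: (e x) (eC x) E => [a b] _ /= ->; rewrite mulrN1z opprB.
Qed.

Lemma cobd_tension (A : zmodType) e (f : edge G -> A) (p : vert G -> A) :
  e \in orientations G -> (forall x, f x = cobd e p x) -> is_tension e f.
Proof.
move=> He fp; apply/forallP => W; apply/forallP => F; apply/forallP => eC.
apply/implyP => /andP[/andP[/and3P[sub _ _] _] dir].
apply/eqP/(etrans _ (direction_sum p sub dir)); apply: eq_bigr => x xF.
by rewrite fp cobd_coupling //; case/andP: dir.
Qed.

(** The edge [x] closes a circuit whose other edges lie in [F]. Both [f] and the coboundary of [p]
    sum to zero around it and agree off [x], hence they agree at [x]. *)
Lemma tension_closes (A : zmodType) e (f : edge G -> A) (p : vert G -> A) F x :
  e \in orientations G -> is_tension e f -> x \notin F ->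
  (forall y, y \in F -> f y = cobd e p y) ->
  connect (adj F) (e x).2 (e x).1 -> f x = cobd e p x.
Proof.
move=> He ft xF fp /connectP[s0 /shortenP[s sP us _] ls].
(* Every edge other than [x] is turned towards larger positions on the path, which makes the path
   directed; [x] keeps its arrow from the last vertex to the first. *)
pose idx v := index v ((e x).2 :: s).
pose D := [set y | (y != x) && (idx (e y).2 < idx (e y).1)%N].
pose e' := flip e D.
have He' : e' \in orientations G by apply: flip_orientation.
have e'x : e' x = e x by rewrite ffunE inE eqxx.
have inc y : y \in F -> (idx (e' y).1 <= idx (e' y).2)%N.
  move=> yF; have yx : y != x by apply: contraNneq xF => <-.
  by rewrite ffunE inE yx /=; case: ltnP => //= /ltnW.
have [|||W [C [c d xC CF]]] := @directed_circuit G Gl e' F x s He'.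
- rewrite e'x; apply/(pathP (e x).2) => i si.
  have /(adj_orient F _ _ He')[y yF Ey] := pathP (e x).2 sP i si.
  apply/exists_inP; exists y => //; case: Ey => [->//|Ey].
  have := inc y yF; rewrite Ey /= /idx.
  rewrite (_ : nth (e x).2 s i = nth (e x).2 ((e x).2 :: s) i.+1) //.
  by rewrite !index_uniq ?ltnn //= ltnW.
- by rewrite e'x.
- by rewrite e'x.
have /forallP/(_ W)/forallP/(_ C)/forallP/(_ e')/implyP := ft.
rewrite c d => /(_ isT)/eqP S1.
have S2 : \sum_(y in C) cobd e' p y = 0.
  by apply: direction_sum d; case/andP: c => /and3P[].
have /andP[oC _] := d.
have : \sum_(y in C) (f y *~ coupling [set: edge G] e C e' y - cobd e' p y) = 0.
  by rewrite sumrB S1 S2 subrr.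
rewrite (bigD1 x) //= big1.
  rewrite addr0 -(cobd_coupling p He oC xC) -mulrzBl /coupling !inE xC e'x eqxx.
  by rewrite mulr1z => /eqP; rewrite subr_eq0 => /eqP.
move=> y /andP[yC yx]; rewrite -(cobd_coupling p He oC yC) fp ?subrr //.
by have /subsetP/(_ y yC) := CF; rewrite !inE (negbTE yx).
Qed.

(** Edges are added one at a time. If the ends of the new edge are already joined, [tension_closes]
    applies; otherwise shifting the potential on the component of its head corrects the value there
    and changes no earlier one. *)
Lemma tension_potential (A : zmodType) e (f : edge G -> A) :
  e \in orientations G -> is_tension e f ->
  exists p : vert G -> A, forall x, f x = cobd e p x.
Proof.
move=> He ft.
suff H (s : seq (edge G)) : exists p : vert G -> A, forall x, x \in s -> f x = cobd e p x.
  by have [p fp] := H (enum (edge G)); exists p => x; apply: fp; rewrite mem_enum.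
elim: s => [|x s [p fp]]; first by exists (fun=> 0).
have fp' y : y \in [set y in s] -> f y = cobd e p y by rewrite inE => /fp.
case xs: (x \in s).
  by exists p => y; rewrite inE => /orP[/eqP->|]; apply: fp.
case cx: (connect (adj [set y in s]) (e x).2 (e x).1).
  exists p => y; rewrite inE => /orP[/eqP->|]; last exact: fp.
  by apply: (tension_closes He ft) fp' cx; rewrite inE xs.
exists (fun w => p w + if connect (adj [set y in s]) (e x).2 w
                       then f x - cobd e p x else 0).
move=> y; rewrite inE /cobd => /orP[/eqP->|ys].
  by rewrite connect0 cx addr0 opprB addrCA [p _ + (_ - _)]addrC subrK addrK.
have -> : connect (adj [set y in s]) (e x).2 (e y).2 =
          connect (adj [set y in s]) (e x).2 (e y).1.
  apply/same_connect_r/connect1; first exact: connect_adj_sym.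
  by apply/adjP; exists y; rewrite ?inE // setUC (orientationP _ He).
by set c := (if _ then _ else _); rewrite fp // /cobd opprD addrACA subrr addr0.
Qed.

Lemma tensionP (A : zmodType) e (f : edge G -> A) : e \in orientations G ->
  reflect (exists p : vert G -> A, forall x, f x = cobd e p x) (is_tension e f).
Proof.
move=> He; apply: (iffP idP) => [|[p]]; first exact: tension_potential.
exact: cobd_tension.
Qed.

End Tensions.

(** * Components, rank and nullity *)

Lemma set_ind (T : finType) (P : {set T} -> Prop) :
  P set0 -> (forall x (A : {set T}), x \notin A -> P A -> P (x |: A)) -> forall A, P A.
Proof.
move=> P0 PU A; have [n] := ubnP #|A|; elim: n A => // n IH A.
have [-> //|[x xA]] := set_0Vmem A; rewrite (cardsD1 x) xA => nA.
by rewrite -(setD1K xA); apply: PU; [rewrite !inE eqxx | apply: IH].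
Qed.

Definition monochromatic (G : graph) (A : eqType) (e : arrows G)
    (p : vert G -> A) : {set edge G} :=
  [set x | p (e x).1 == p (e x).2].

Section Components.
Variable G : graph.
Implicit Types (e r : arrows G) (x : edge G) (F B : {set edge G}).

Lemma monochromatic_connect (A : eqType) e (p : vert G -> A) F :
  e \in orientations G -> F \subset monochromatic e p ->
  forall u v, connect (adj F) u v -> p u = p v.
Proof.
move=> He /subsetP sF u v /connectP[s sP ->].
elim: s u sP => //= w s IH u /andP[/(adj_orient _ _ _ He)[x xF Ex] /IH <-].
by have := sF x xF; rewrite inE; case: Ex => -> /eqP.
Qed.

(** Such a colouring is constant on each component and free on the component roots. With two
    colours, facts about [ncomp] can then be read off from sets of 0-1 colourings. *)
Lemma card_monochromatic (A : finType) (a0 : A) e F : e \in orientations G ->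
  #|[set p : {ffun vert G -> A} | F \subset monochromatic e p]| = (#|A| ^ ncomp F)%N.
Proof.
move=> He; pose rt := fingraph.root (adj F); have sym := connect_adj_sym F.
rewrite /ncomp /n_comp_mem (eq_card (B := roots (adj F))); last by move=> v; rewrite !inE andbT.
rewrite -(card_pffun_on a0 (roots (adj F)) A).
pose ext (g : {ffun vert G -> A}) := [ffun v => g (rt v)].
rewrite -[RHS](card_in_imset (f := ext)).
  apply: eq_card => p; rewrite inE; apply/idP/imsetP => [sF|[g _ ->]].
    exists [ffun v => if v \in roots (adj F) then p v else a0].
      apply/pffun_onP; split=> [|a /imageP[v _ ->] //].
      by apply/subsetP => v; rewrite inE ffunE; case: ifP => //; rewrite eqxx.
    apply/ffunP => v; rewrite !ffunE [_ \in _](roots_root sym).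
    exact/(monochromatic_connect He sF)/connect_root.
  apply/subsetP => x xF; rewrite inE !ffunE; apply/eqP; congr (g _).
  apply/(fingraph.rootP sym)/connect1/(adj_orient _ _ _ He); exists x => //.
  by left; apply: surjective_pairing.
move=> g h /pffun_onP[/subsetP sg _] /pffun_onP[/subsetP sh _] E.
apply/ffunP => v; have : ext g (rt v) = ext h (rt v) by rewrite E.
rewrite !ffunE /rt (root_root sym).
have [vr|nv _] := boolP (v \in roots (adj F)); first by move: vr; rewrite inE => /eqP ->.
have out (k : {ffun vert G -> A}) : {subset support_for a0 k <= mem (roots (adj F))} -> k v = a0.
  by move=> sk; apply/eqP; apply: contraNT nv => kv; apply: sk.
by rewrite !out.
Qed.

Lemma leq_ncomp F B : F \subset B -> (ncomp B <= ncomp F)%N.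
Proof.
have [e He] := orientation_exists G => sFB.
rewrite -(leq_exp2l (m := 2)) // -card_bool -!(card_monochromatic false _ He).
by apply/subset_leq_card/subsetP => p; rewrite !inE; apply: subset_trans.
Qed.

Lemma ncomp0 : ncomp (set0 : {set edge G}) = #|vert G|.
Proof.
have [e He] := orientation_exists G.
apply/(@expnI 2); rewrite // -card_bool -(card_monochromatic false _ He) -card_ffun.
by apply: eq_card => p; rewrite !inE sub0set.
Qed.

(* Toggling a 0-1 colouring on the component of an end of x pairs the colourings
   constant on the components of F that are monochromatic on x with the others. *)
Lemma ncompU1 e F x : e \in orientations G ->
  (ncomp (x |: F) + ~~ connect (adj F) (e x).1 (e x).2)%N = ncomp F.
Proof.
move=> He; apply/(@expnI 2); rewrite // expnD -card_bool.
rewrite -!(card_monochromatic false _ He).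
set P := [set p | F \subset _]; set Q := [set p | _ |: _ \subset _].
have QE p : (p \in Q) = (p \in P) && (p (e x).1 == p (e x).2).
  by rewrite !inE subUset sub1set inE andbC.
case: (boolP (connect _ _ _)) => cx.
  rewrite muln1; apply: eq_card => p; rewrite QE.
  case: (boolP (p \in P)) => //=; rewrite inE => pP.
  by apply/eqP/(monochromatic_connect He pP).
rewrite card_bool expn1 muln2 -addnn -[RHS](cardsID [set p : {ffun vert G -> bool} | p (e x).1 == p (e x).2]).
congr (_ + _)%N; first by apply: eq_card => p; rewrite QE !inE.
pose tog (p : {ffun vert G -> bool}) := [ffun w => p w (+) connect (adj F) (e x).1 w].
have togK : involutive tog.
  by move=> p; apply/ffunP => w; rewrite !ffunE -addbA addbb addbF.
have togP p : (tog p \in P) = (p \in P).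
  rewrite !inE; apply/subsetP/subsetP => H y yF; have := H y yF; rewrite !inE ?ffunE;
    (have -> : connect (adj F) (e x).1 (e y).1 = connect (adj F) (e x).1 (e y).2;
      [ apply/(same_connect_r (connect_adj_sym F))/connect1/(adj_orient _ _ _ He);
        by exists y => //; left; apply: surjective_pairing
      | by rewrite (inj_eq (@addIb _)) ]).
rewrite -(card_imset _ (inv_inj togK)); apply: eq_card => p.
rewrite -{1}(togK p) mem_imset; last exact: inv_inj togK.
rewrite QE togP !inE !ffunE connect0 (negbTE cx) addbF addbT.
by rewrite andbC; case: (p _) (p _) => [] [].
Qed.

Lemma ncomp_le F : (ncomp F <= #|vert G|)%N.
Proof. by rewrite -ncomp0 leq_ncomp ?sub0set. Qed.

(** Adding an edge merges at most two components. This makes the truncated subtraction in [nullity]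
    exact. *)
Lemma card_ncomp F : (#|vert G| <= #|F| + ncomp F)%N.
Proof.
have [e He] := orientation_exists G.
elim/set_ind: F => [|x F xF IH]; first by rewrite ncomp0 cards0.
by rewrite cardsU1 xF; have := ncompU1 F x He; move: IH; move: (ncomp F) (ncomp _) #|vert G| => a b c;
  case: connect => /=; lia.
Qed.

Lemma nullityE F : (nullity F + #|vert G| = #|F| + ncomp F)%N.
Proof. by have := card_ncomp F; have := ncomp_le F; rewrite /nullity /rk; lia. Qed.

Lemma nullityU1 e F x : e \in orientations G -> x \notin F ->
  nullity (x |: F) = (nullity F + connect (adj F) (e x).1 (e x).2)%N.
Proof.
move=> He xF; have := nullityE F; have := nullityE (x |: F).
have := ncompU1 F x He; rewrite cardsU1 xF.
by case: connect => /=; lia.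
Qed.

Lemma rk_ncomp F : (rkG G - rk F = ncomp F - ncomp [set: edge G])%N.
Proof.
have := ncomp_le F; have := ncomp_le [set: edge G]; have := leq_ncomp (subsetT F).
by rewrite /rkG /rk; lia.
Qed.

Lemma rk_le F : (rk F <= rkG G)%N.
Proof.
have := ncomp_le F; have := ncomp_le [set: edge G]; have := leq_ncomp (subsetT F).
by rewrite /rkG /rk; lia.
Qed.

Lemma rk_nullity F : (rk F + nullity F = #|F|)%N.
Proof. by have := nullityE F; have := ncomp_le F; rewrite /rk; lia. Qed.

End Components.

(** * The tension polynomial and the Tutte polynomial at y = 0 *)

Lemma poly_eqP_nat (P Q : {poly rat}) (n0 : nat) :
  (forall n, (n0 <= n)%N -> P.[n%:R] = Q.[n%:R]) -> P = Q.
Proof.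
move=> H; apply/eqP; rewrite -subr_eq0; apply/eqP.
pose s := [seq (n0 + i)%:R : rat | i <- iota 0 (size (P - Q))].
apply: (@roots_geq_poly_eq0 _ _ s).
- apply/allP => _ /mapP[i _ ->].
  by rewrite /root hornerD hornerN H ?leq_addr // subrr.
- rewrite map_inj_in_uniq ?iota_uniq // => i j _ _ /eqP.
  by rewrite eqr_nat eqn_add2l => /eqP.
- by rewrite size_map size_iota.
Qed.

Section TauPolynomial.
Variable G : graph.
Implicit Types (e r : arrows G) (x : edge G) (F B : {set edge G}).

(** Subtracting [p0] turns the potentials of [f] into those of the zero tension, which are the
    colourings constant on components. *)
Lemma card_potentials (A : finZmodType) e (f : edge G -> A) (p0 : vert G -> A) :
  e \in orientations G -> (forall x, f x = cobd e p0 x) ->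
  #|[set p : {ffun vert G -> A} | [forall x, cobd e p x == f x]]|
  = (#|A| ^ ncomp [set: edge G])%N.
Proof.
move=> He fp; rewrite -(card_monochromatic 0 _ He).
pose sh (p : {ffun vert G -> A}) := [ffun v => p v - p0 v].
have sh_inj : injective sh.
  move=> p s E; apply/ffunP => v.
  have : sh p v = sh s v by rewrite E.
  by rewrite !ffunE => /addIr.
rewrite -(card_imset _ sh_inj); apply: eq_card => p; rewrite !inE.
apply/imsetP/subsetP => [[s]|H].
  rewrite inE => /forallP H -> x _; rewrite inE !ffunE eq_sym -subr_eq0.
  by have := cobdB e s p0 x; rewrite (eqP (H x)) fp subrr => /eqP.
exists [ffun v => p v + p0 v]; last by apply/ffunP => v; rewrite !ffunE addrK.
rewrite inE; apply/forallP => x; rewrite fp /cobd !ffunE opprD addrACA.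
by have := H x (in_setT x); rewrite inE => /eqP ->; rewrite subrr add0r.
Qed.

(** The sum is the expansion of the product of [1 - [x in M]] over all [x], which vanishes as soon
    as [M] has an element. *)
Lemma sum_sign_subset (T : finType) (M : {set T}) :
  \sum_(B : {set T} | B \subset M) (-1) ^+ #|B| = (M == set0)%:R :> int.
Proof.
have : \prod_(x : T) ((- (x \in M)%:R) + 1) = (M == set0)%:R :> int.
  have [->|/set0Pn[x xM]] := eqVneq M set0.
    by rewrite big1 // => x _; rewrite inE oppr0 add0r.
  by rewrite (bigD1 x) //= xM addNr mul0r.
move <-; rewrite bigA_distr big_mkcond /=; apply: eq_bigr => B _.
case: ifP => [/subsetP sBM|/negbT/subsetPn[x xB xM]]; last first.
  by rewrite (bigD1 x) //= xB (negbTE xM) oppr0 mul0r.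
rewrite -big_mkcond /= -prodr_const; apply: eq_bigr => x /sBM ->.
by [].
Qed.

(** Inclusion-exclusion over the edges forced to be monochromatic: Whitney's expansion of the
    chromatic polynomial. *)
Lemma card_proper (A : finType) (a0 : A) e : e \in orientations G ->
  #|[set p : {ffun vert G -> A} | monochromatic e p == set0]|%:R
  = \sum_(B : {set edge G}) (-1) ^+ #|B| * (#|A| ^ ncomp B)%:R :> int.
Proof.
move=> He.
under eq_bigr => B _ do rewrite -(card_monochromatic a0 B He) -sum1dep_card natr_sum mulr_sumr.
rewrite (exchange_big_dep predT) //= -sum1dep_card natr_sum big_mkcond /=.
apply: eq_bigr => p _; under eq_bigr => B _ do rewrite mulr1.
by rewrite sum_sign_subset; case: eqP.
Qed.

(** The coboundary maps proper colourings onto nowhere-zero tensions, and by [card_potentials] all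
    fibres have the same size. *)
Lemma card_nz_tensions (A : finZmodType) e : loopless G -> e \in orientations G ->
  (#|nz_tensions A e| * #|A| ^ ncomp [set: edge G])%N =
  #|[set p : {ffun vert G -> A} | monochromatic e p == set0]|.
Proof.
move=> Gl He; pose d (p : {ffun vert G -> A}) := [ffun x => cobd e p x].
rewrite -[RHS]sum1dep_card (partition_big d (mem (nz_tensions A e))) /=; last first.
  move=> p /eqP /setP M; rewrite inE; apply/andP; split.
    by apply/(tensionP Gl _ He); exists p => x; rewrite ffunE.
  apply/forallP => x; rewrite ffunE subr_eq0 eq_sym.
  by have := M x; rewrite !inE => ->.
rewrite -sum_nat_const; apply: eq_bigr => f; rewrite inE => /andP[].
move=> /(tensionP Gl _ He)[p0 fp] /forallP fnz.
rewrite -(card_potentials He fp) -sum1dep_card; apply: eq_bigl => p.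
apply/forallP/andP => [H|[_ /eqP <-] x]; last by rewrite ffunE.
split; last by apply/eqP/ffunP => x; rewrite ffunE; apply/eqP.
apply/eqP/setP => x; rewrite !inE eq_sym -subr_eq0 -/(cobd e p x) (eqP (H x)).
exact/negbTE.
Qed.

(** The chromatic polynomial in Whitney's form, divided by [t ^ k(G)]. *)
Definition tau_expansion : {poly rat} :=
  \sum_(B : {set edge G}) (-1) ^+ #|B| *: 'X^(rkG G - rk B).

(** Both kinds of tension are counted through their potentials, which brings in a factor [a ^ k(G)];
    this lemma absorbs it for both polynomials. *)
Lemma horner_ncomp (c : {set edge G} -> rat) (a : rat) :
  (\sum_(B : {set edge G}) c B *: 'X^(rkG G - rk B)).[a] * a ^+ ncomp [set: edge G]
  = \sum_(B : {set edge G}) c B * a ^+ ncomp B.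
Proof.
rewrite horner_sum mulr_suml; apply: eq_bigr => B _.
by rewrite hornerZ hornerXn -mulrA -exprD rk_ncomp subnK // leq_ncomp // subsetT.
Qed.

Lemma is_tau_poly_expansion : loopless G -> is_tau_poly G tau_expansion.
Proof.
move=> Gl A e He.
have A0 : #|A|%:R != 0 :> rat by rewrite pnatr_eq0 -lt0n; apply/card_gt0P; exists 0.
apply: (mulIf (expf_neq0 (ncomp [set: edge G]) A0)).
rewrite horner_ncomp -natrX -natrM card_nz_tensions //.
rewrite -[LHS](_ : (\sum_(B : {set edge G}) (-1) ^+ #|B| * (#|A| ^ ncomp B)%:R)%:~R = _).
  by rewrite -(card_proper 0 He) -[RHS]/(_ %:Z%:~R) natz.
rewrite rmorph_sum /=; apply: eq_bigr => B _.
by rewrite rmorphM rmorphXn rmorphN1 /= -natrX -[RHS]/(_ * _%:Z%:~R) natz.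
Qed.

Lemma tau_eq : loopless G -> tau G = tau_expansion.
Proof.
move=> Gl; have H := is_tau_poly_expansion Gl.
have H' : is_tau_poly G (tau G).
  by apply: (@ClassicalEpsilon.epsilon_spec _ (inhabits 0) (is_tau_poly G)); exists tau_expansion.
have [e He] := orientation_exists G.
(* Only positive orders occur, hence the bound 1; the cyclic groups ['I_n.+1] realize all of
   them. *)
apply: (@poly_eqP_nat _ _ 1) => -[//|n] _.
by have := H 'I_n.+1 e He; have := H' 'I_n.+1 e He; rewrite card_ord => -> ->.
Qed.

Lemma nullity_sign B : (-1) ^+ nullity B = (-1) ^+ #|B| * (-1) ^+ rk B :> rat.
Proof. by rewrite -(rk_nullity B) exprD mulrAC -expr2 sqrr_sign mul1r. Qed.

(** This is [T(G; t + 1, 0)]: at [y = 0] the factor [y - 1] becomes a sign, and [x - 1] becomes [t].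
    It will turn out to be bar-tau. *)
Definition tutte_shift : {poly rat} :=
  \sum_(B : {set edge G}) (-1) ^+ nullity B *: 'X^(rkG G - rk B).

(** Substituting [1 - t] produces the sign [(-1)^(r(E) - r(B))]; together with [(-1)^r(E)] it leaves
    [(-1)^r(B)], which turns [(-1)^|B|] into [(-1)^n(B)]. *)
Lemma tau_tutte : (-1) ^+ rkG G *: (tau_expansion \Po (1 - 'X)) = tutte_shift \Po ('X - 1).
Proof.
rewrite !rmorph_sum /= scaler_sumr; apply: eq_bigr => B _.
rewrite !comp_polyZ !comp_Xn_poly scalerA.
rewrite -[1 - 'X]opprB -[- ('X - 1)]scaleN1r exprZn scalerA; congr (_ *: _).
rewrite nullity_sign mulrAC mulrC; congr (_ * _).
by rewrite -{1}(subnKC (rk_le B)) exprD -mulrA -expr2 sqrr_sign mulr1.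
Qed.

Lemma tutte_y0 : map_poly (horner_eval 0) (tutte G) = tutte_shift \Po ('X - 1).
Proof.
rewrite !rmorph_sum /=; apply: eq_bigr => B _.
rewrite comp_polyZ comp_Xn_poly rmorphM !rmorphXn !rmorphB /= map_polyX rmorph1.
rewrite map_polyC /= /horner_eval hornerX mulrC -mul_polyC rmorphXn.
by rewrite rmorphN1 polyC0 sub0r.
Qed.

Lemma tutte_10 : (tutte G).[1, 0] = tutte_shift.[0].
Proof.
rewrite !horner_sum; apply: eq_bigr => B _.
by rewrite !(hornerE, horner_exp) mulrC subrr.
Qed.

End TauPolynomial.

(** * Deletion-contraction for rooted acyclic orientations *)

Definition add_pair (T : eqType) (s : rel T) (u v : T) : rel T :=
  fun a b => s a b || ((a == u) && (b == v)).

(** A walk can be shortened between its first and its last use of the new pair, so one use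
    suffices. *)
Lemma connect_add_pair (T : finType) (s : rel T) u v a b :
  connect (add_pair s u v) a b = connect s a b || (connect s a u && connect s v b).
Proof.
have sub : subrel (connect s) (connect (add_pair s u v)).
  by apply: connect_sub => c d cd; apply: connect1; rewrite /add_pair cd.
apply/idP/orP => [/connectP[p pP ->]|[/sub //|/andP[/sub H1 /sub H2]]].
  elim: p a pP => [|c p IH] a /=; first by left.
  move=> /andP[/orP[ac|/andP[/eqP -> /eqP ->]] /IH[]].
  - by left; apply: connect_trans (connect1 ac) _.
  - by case/andP=> cu ->; right; rewrite (connect_trans (connect1 ac) cu).
  - by move=> ->; right; rewrite connect0.
  - by case/andP=> _ ->; right; rewrite connect0.
apply: connect_trans H1 _; apply: connect_trans H2; apply: connect1.
by rewrite /add_pair !eqxx orbT.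
Qed.

(* The orientation of the edges in H by [flip e D], the edges in C being
   traversable in both directions. *)
Definition step (G : graph) (e : arrows G) (H C D : {set edge G}) : rel (vert G) :=
  fun u v => [exists x in H, flip e D x == (u, v)] || adj C u v.

Definition reaches (T : finType) (R : {set T}) (s : rel T) : bool :=
  [forall v, exists r in R, connect s r v].

(** Acyclicity in a minor. The walks of [s] may also cross contracted edges in both directions,
    hence [s] is kept apart from the arrows [o]. *)
Definition no_return (G : graph) (H : {set edge G}) (o : arrows G)
    (s : rel (vert G)) : bool :=
  [forall x in H, ~~ connect s (o x).2 (o x).1].

(** This describes orientations of the minor that keeps [H] and contracts [C]. Taking all vertices
    for [R] gives plain acyclic orientations; taking one root per component gives the
    representatives of the cut-equivalence classes. *)
Definition rooted_acyclic (G : graph) (R : {set vert G}) (e : arrows G)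
    (H C D : {set edge G}) : bool :=
  no_return H (flip e D) (step e H C D) && reaches R (step e H C D).

Section DeletionContraction.
Variables (G : graph) (R : {set vert G}).
Implicit Types (e : arrows G) (x : edge G) (H C D B : {set edge G}).

Lemma eq_reaches (s t : rel (vert G)) :
  connect s =2 connect t -> reaches R s = reaches R t.
Proof. by move=> st; apply: eq_forallb => v; apply: eq_existsb => r; rewrite st. Qed.

Lemma eq_no_return H o (s t : rel (vert G)) :
  connect s =2 connect t -> no_return H o s = no_return H o t.
Proof. by move=> st; apply: eq_forallb => v; rewrite st. Qed.

Lemma reachesP (s : rel (vert G)) :
  reflect (forall v, exists2 r, r \in R & connect s r v) (reaches R s).
Proof. by apply: (iffP forallP) => H v; apply/exists_inP. Qed.

(** When [C] does not join [u] and [v], this supplies an arrow on the walk; a walk back from [v] to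
    [u] then violates [no_return] at that arrow. *)
Lemma step_uses_arrow e H C D u v : connect (step e H C D) u v ->
  connect (adj C) u v \/
  exists2 x, x \in H & connect (step e H C D) u (flip e D x).1 /\
                       connect (step e H C D) (flip e D x).2 v.
Proof.
move=> /connectP[p pP ->]; elim: p u pP => [|w p IH] u /=; first by left.
move=> /andP[uw pP]; have wl : connect (step e H C D) w (last w p).
  by apply/connectP; exists p.
case/orP: (uw) => [/exists_inP[x xH /eqP E]|Cuw].
  by right; exists x; rewrite // E /= connect0.
case: (IH w pP) => [cw|[x xH [H1 H2]]]; first by left; apply: connect_trans (connect1 Cuw) cw.
by right; exists x => //; split=> //; apply: connect_trans (connect1 uw) H1.
Qed.

(* Here s is what remains after deleting an edge with ends u and v: the left side
   counts its two orientations, the right side its deletion and contraction. *)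
Lemma rooted_acyclic_delete e H C D u v : 
  let s := step e H C D in let o := flip e D in
  ~~ connect (adj C) u v -> (exists2 r, r \in R & connect s r u) ->
  (  ([&& no_return H o (add_pair s u v), ~~ connect (add_pair s u v) v u & reaches R (add_pair s u v)] : nat)
   + ([&& no_return H o (add_pair s v u), ~~ connect (add_pair s v u) u v & reaches R (add_pair s v u)] : nat)
  = ((no_return H o s && reaches R s) : nat)
   + ((let t := add_pair (add_pair s u v) v u in no_return H o t && reaches R t) : nat))%N.
Proof.
move=> s o nC [r0 r0R r0u].
have sym := connect_adj_sym C.
have nC' : ~~ connect (adj C) v u by rewrite sym.
have uses a b : ~~ connect (adj C) a b -> connect s a b ->
    exists2 x, x \in H & connect s a (o x).1 /\ connect s (o x).2 b.
  by move=> nab /step_uses_arrow[c|//]; rewrite c in nab.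
have arr x : x \in H -> connect s (o x).1 (o x).2.
  move=> xH; apply/connect1/orP; left; apply/exists_inP; exists x => //.
  by rewrite -surjective_pairing.
(* An arrow into [u] adds nothing to reachability, as [u] is already reached from [r0]. *)
have rvu (t : rel (vert G)) : subrel (connect s) (connect t) -> reaches R (add_pair t v u) = reaches R t.
  move=> st; apply/reachesP/reachesP => h w; have [r rR rw] := h w.
    move: rw; rewrite connect_add_pair => /orP[rw|/andP[_ uw]]; first by exists r.
    by exists r0 => //; apply: connect_trans (st _ _ r0u) uw.
  by exists r; rewrite // connect_add_pair rw.
have sub : subrel (connect s) (connect (add_pair s u v)).
  by move=> a b ab; rewrite connect_add_pair ab.
rewrite (rvu s) //= (rvu _ sub).
have ruv : connect s u v -> reaches R (add_pair s u v) = reaches R s.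
  move=> uv; apply: eq_reaches => a b; rewrite connect_add_pair.
  case: (boolP (connect s a b)) => //= nab; apply/negbTE; apply: contra nab.
  by case/andP=> au vb; apply: connect_trans au (connect_trans uv vb).
have nr_sub (t t' : rel (vert G)) : subrel (connect t) (connect t') ->
    no_return H o t' -> no_return H o t.
  move=> st /forall_inP h; apply/forall_inP => x /h; apply: contra; exact: st.
have sub' : subrel (connect s) (connect (add_pair s v u)).
  by move=> a b ab; rewrite connect_add_pair ab.
have sub2 : subrel (connect (add_pair s u v)) (connect (add_pair (add_pair s u v) v u)).
  by move=> a b ab; rewrite connect_add_pair ab.
have [A|nA] := boolP (no_return H o s); last first.
  have n1 : no_return H o (add_pair s u v) = false.
    by apply: contraNF nA; apply: nr_sub.
  have n2 : no_return H o (add_pair s v u) = false.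
    by apply: contraNF nA; apply: nr_sub.
  rewrite n1 n2 /=; case: (boolP (no_return _ _ _)) => //= h.
  by move: n1; rewrite (nr_sub _ _ sub2 h).
have A' x : x \in H -> ~~ connect s (o x).2 (o x).1 by move/forall_inP: A; apply.
have cyc a b c : connect s a b -> connect s b c -> connect s a c by exact: connect_trans.
have excl : connect s u v -> ~~ connect s v u.
  move=> uv; apply/negP => vu; have [x xH [h1 h2]] := uses _ _ nC uv.
  by case/negP: (A' x xH); apply: cyc h2 (cyc _ _ _ vu h1).
have half a b : ~~ connect s b a -> no_return H o (add_pair s a b).
  move=> nba; apply/forall_inP => x xH; rewrite connect_add_pair (negbTE (A' x xH)) /=.
  apply: contra nba => /andP[h1 h2]; exact: cyc h2 (cyc _ _ _ (arr x xH) h1).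
have c1 : connect (add_pair s u v) v u = connect s v u.
  by rewrite connect_add_pair andbb orbb.
have c2 : connect (add_pair s v u) u v = connect s u v.
  by rewrite connect_add_pair andbb orbb.
rewrite c1 c2.
(* If [s] joins [u] and [v] in one direction, only the orientation in that direction survives, and
   contraction creates a return. Otherwise nothing creates a return: the arrow from [v] to [u]
   matches the deletion, the opposite one the contraction. *)
case: (boolP (connect s u v)) => uv; [|case: (boolP (connect s v u)) => vu].
- rewrite (negbTE (excl uv)) (half _ _ (excl uv)) ruv //= andbF.
  rewrite (_ : no_return _ _ _ = false) //; apply/negP => /forall_inP h.
  have [x xH [h1 h2]] := uses _ _ nC uv; case/negP: (h x xH).
  rewrite connect_add_pair; apply/orP; right.
  by apply/andP; split; apply: sub.
- rewrite andbF (half _ _ uv) /= add0n.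
  rewrite (_ : no_return _ _ (add_pair _ _ _) = false) ?addn0 //; apply/negP => /forall_inP h.
  have [x xH [h1 h2]] := uses _ _ nC' vu; case/negP: (h x xH).
  apply: sub2; rewrite connect_add_pair; apply/orP; right.
  by apply/andP; split.
- rewrite (half _ _ uv) (half _ _ vu) /= addnC; congr (_ + nat_of_bool _)%N.
  rewrite (_ : no_return _ _ _ = true) //.
  apply/forall_inP => x xH; rewrite !connect_add_pair (negbTE (A' x xH)) /=.
  have := arr x xH => ax.
  apply/negP; case/orP=> [/andP[h1 h2]|/andP[/orP[h1|/andP[h1 _]] /orP[h2|/andP[_ h2]]]].
  + by case/negP: vu; apply: cyc h2 (cyc _ _ _ ax h1).
  + by case/negP: uv; apply: cyc h2 (cyc _ _ _ ax h1).
  + by case/negP: (A' x xH); apply: cyc h1 h2.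
  + by case/negP: (A' x xH); apply: cyc h1 h2.
  + by case/negP: vu; apply: cyc h2 (cyc _ _ _ ax h1).
Qed.
End DeletionContraction.

Lemma sum_subsetsD1 (T : finType) (V : nmodType) (H : {set T}) x (F : {set T} -> V) :
  x \in H ->
  \sum_(B : {set T} | B \subset H) F B =
  \sum_(B : {set T} | B \subset H :\ x) (F B + F (x |: B)).
Proof.
move=> xH; rewrite (bigID (fun B : {set T} => x \notin B)) /= big_split /=.
congr (_ + _); first by apply: eq_bigl => B; rewrite subsetD1.
rewrite (reindex_onto (fun B => x |: B) (fun B => B :\ x)) /=; last first.
  by move=> B /andP[_]; rewrite negbK => /setD1K.
apply: eq_bigl => B; rewrite setU11 /= andbT subsetD1 subUset sub1set xH /=.
have [xB|xB] := boolP (x \in B); last by rewrite setU1K // eqxx.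
by rewrite andbF; apply/negP => /andP[_ /eqP E]; move: xB; rewrite -E !inE eqxx.
Qed.

(** * The signed sum over edge sets that results from the recursion *)

Section DeletionContractionSum.
Variables (G : graph) (R : {set vert G}).
Implicit Types (e : arrows G) (x : edge G) (H C D B : {set edge G}).

Lemma step_delete e H C D x u v : x \in H -> flip e D x = (u, v) ->
  step e H C D =2 add_pair (step e (H :\ x) C D) u v.
Proof.
move=> xH Ex a b; rewrite /step /add_pair orbAC; congr (_ || _).
apply/exists_inP/orP => [[y yH /eqP Ey]|[/exists_inP[y]|/andP[/eqP-> /eqP->]]].
- have [yx|yx] := eqVneq y x; last by left; apply/exists_inP; exists y; rewrite ?inE ?yx ?Ey.
  by right; move: Ey; rewrite yx Ex => -[-> ->]; rewrite !eqxx.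
- by rewrite !inE => /andP[_ yH] Ey; exists y.
- by exists x; rewrite // Ex.
Qed.

Lemma step_flipU1 e H C D x : step e (H :\ x) C (x |: D) =2 step e (H :\ x) C D.
Proof.
move=> a b; rewrite /step; congr (_ || _); apply: eq_existsb => y.
by rewrite !inE !ffunE !inE; case: eqP.
Qed.

Lemma step_contract e H C D x : e \in orientations G ->
  step e (H :\ x) (x |: C) D =2
  add_pair (add_pair (step e (H :\ x) C D) (e x).1 (e x).2) (e x).2 (e x).1.
Proof.
move=> He a b; rewrite /add_pair /step -!orbA; congr (_ || _).
apply/(adj_orient _ _ _ He)/or3P => [[y]|].
  rewrite !inE => /orP[/eqP -> [] ->|yC Ey]; first by constructor 2; rewrite !eqxx.
    by constructor 3; rewrite !eqxx.
  by constructor 1; apply/(adj_orient _ _ _ He); exists y.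
case=> [/(adj_orient _ _ _ He)[y yC Ey]|/andP[/eqP-> /eqP->]|/andP[/eqP-> /eqP->]].
- by exists y; rewrite // !inE yC orbT.
- by exists x; rewrite ?inE ?eqxx //; left; apply: surjective_pairing.
- by exists x; rewrite ?inE ?eqxx //; right; apply: surjective_pairing.
Qed.

Lemma no_returnD1 H o x (s : rel (vert G)) : x \in H ->
  no_return H o s = no_return (H :\ x) o s && ~~ connect s (o x).2 (o x).1.
Proof.
move=> xH; apply/forall_inP/andP => [h|[/forall_inP h hx] y yH].
  by split; [apply/forall_inP => y; rewrite !inE => /andP[_ /h] | apply: h].
by have [->//|yx] := eqVneq y x; apply: h; rewrite !inE yx.
Qed.

Lemma no_return_flipU1 H e D x (s : rel (vert G)) :
  no_return (H :\ x) (flip e (x |: D)) s = no_return (H :\ x) (flip e D) s.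
Proof.
by apply: eq_forallb => y; rewrite !inE !ffunE !inE; case: eqP.
Qed.

Lemma rooted_acyclic_out e H C D x : x \in H -> x \notin D ->
  let s := add_pair (step e (H :\ x) C D) (e x).1 (e x).2 in
  rooted_acyclic R e H C D =
  [&& no_return (H :\ x) (flip e D) s, ~~ connect s (e x).2 (e x).1 & reaches R s].
Proof.
move=> xH xD s; have Ex : flip e D x = e x by rewrite ffunE (negbTE xD).
have E : connect (step e H C D) =2 connect s.
  by apply/eq_connect/step_delete; rewrite // Ex -surjective_pairing.
by rewrite /rooted_acyclic (eq_reaches _ E) (eq_no_return _ _ E) (no_returnD1 _ _ xH) Ex andbA.
Qed.

Lemma rooted_acyclic_in e H C D x : x \in H ->
  let s := add_pair (step e (H :\ x) C D) (e x).2 (e x).1 in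
  rooted_acyclic R e H C (x |: D) =
  [&& no_return (H :\ x) (flip e D) s, ~~ connect s (e x).1 (e x).2 & reaches R s].
Proof.
move=> xH s; have Ex : flip e (x |: D) x = swap (e x) by rewrite ffunE setU11.
have E : connect (step e H C (x |: D)) =2 connect s.
  move=> a b; rewrite (eq_connect (step_delete _ xH Ex)) /s !connect_add_pair.
  by rewrite !(eq_connect (@step_flipU1 _ _ _ _ _)).
rewrite /rooted_acyclic (eq_reaches _ E) (eq_no_return _ _ E) (no_returnD1 _ _ xH) Ex /=.
by rewrite no_return_flipU1 andbA.
Qed.

(** This is [rooted_acyclic_delete] applied to [x], with its ends exchanged when it is the head that
    is reached from [R] through [C]. *)
Lemma rooted_acyclic_split e H C D x : e \in orientations G ->
  x \in H -> x \notin D -> ~~ connect (adj C) (e x).1 (e x).2 ->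
  (exists2 r, r \in R & connect (adj C) r (e x).1 || connect (adj C) r (e x).2) ->
  (rooted_acyclic R e H C D + rooted_acyclic R e H C (x |: D) =
   rooted_acyclic R e (H :\ x) C D + rooted_acyclic R e (H :\ x) (x |: C) D)%N.
Proof.
move=> He xH xD nC [r rR rx].
have sC : subrel (connect (adj C)) (connect (step e (H :\ x) C D)).
  by apply: connect_sub => a b ab; apply: connect1; rewrite /step ab orbT.
have E := eq_connect (step_contract H C D x He).
rewrite (rooted_acyclic_out _ _ xH xD) (rooted_acyclic_in _ _ _ xH).
rewrite [in RHS]/rooted_acyclic (eq_reaches _ E) (eq_no_return _ _ E).
case/orP: rx => rx.
  by apply: rooted_acyclic_delete => //; exists r => //; apply: sC.
have nC' : ~~ connect (adj C) (e x).2 (e x).1 by rewrite (connect_adj_sym C).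
have rx' : exists2 r, r \in R & connect (step e (H :\ x) C D) r (e x).2.
  by exists r => //; apply: sC.
have := rooted_acyclic_delete nC' rx'; rewrite /= => E'.
rewrite addnC E'; congr (_ + nat_of_bool (_ && _))%N.
  by apply: eq_no_return; apply: eq_connect => a b; rewrite /add_pair orbAC.
by apply: eq_reaches; apply: eq_connect => a b; rewrite /add_pair orbAC.
Qed.

Lemma reaches_stuck C (t : rel (vert G)) :
  (forall r a b, r \in R -> connect (adj C) r a -> t a b -> adj C a b) ->
  reaches R t -> reaches R (adj C).
Proof.
move=> h /reachesP rt; apply/reachesP => v; have [r rR /connectP[p pP ->]] := rt v.
exists r => //; elim/last_ind: p pP => [|p w IH]; first by rewrite connect0.
rewrite rcons_path last_rcons => /andP[/IH c tw].
by apply: connect_trans c (connect1 (h _ _ _ rR c tw)).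
Qed.

(** The sign is that of [n(B u C) - n(C)], the nullity of [B] after contracting [C]; only its parity
    matters, so a sum serves. *)
Definition signed_spanning (C B : {set edge G}) : int :=
  if reaches R (adj (B :|: C)) then (-1) ^+ (nullity (B :|: C) + nullity C) else 0.

(** Induction on [H], each time splitting at an edge that touches the region reached from [R]
    through [C], as [rooted_acyclic_split] requires. *)
Lemma sum_rooted_acyclic e H C : e \in orientations G -> [disjoint H & C] ->
  \sum_(D : {set edge G} | D \subset H) (rooted_acyclic R e H C D : nat)%:R =
  \sum_(B : {set edge G} | B \subset H) signed_spanning C B.
Proof.
move=> He; have [n] := ubnP #|H|; elim: n H C => // n IH H C nH dHC.
pose touch x := [exists r in R, connect (adj C) r (e x).1 || connect (adj C) r (e x).2].
have [/exists_inP[x xH /exists_inP[r rR rx]]|nt] := boolP [exists x in H, touch x].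
  have xC : x \notin C by rewrite (disjointFr dHC).
  rewrite !(sum_subsetsD1 _ xH).
  (* If [C] already joins its ends, [x] is a loop of the contraction. No orientation is then
     acyclic, and on the right adding [x] to [B] preserves reachability and flips the sign, so the
     terms cancel in pairs. *)
  have [cx|cx] := boolP (connect (adj C) (e x).1 (e x).2).
    rewrite !big1 // => D.
      have sub B : subrel (connect (adj C)) (connect (adj (B :|: C))).
        exact: sub_adj (subsetUr B C).
      rewrite subsetD1 => /andP[_ xD].
      have E : connect (adj (x |: (D :|: C))) =2 connect (adj (D :|: C)).
        move=> a b; apply/idP/idP; last by move=> h; apply: (sub_adj (subsetUr [set x] (D :|: C)) h).
        move: a b; apply: connect_sub => a b /(adj_orient _ _ _ He)[y].
        rewrite inE => /orP[]; last first.
          by move=> yD Ey; apply/connect1/(adj_orient _ _ _ He); exists y.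
        rewrite inE => /eqP -> [] Ey; last rewrite (connect_adj_sym (D :|: C));
          by have := sub D _ _ cx; rewrite Ey.
      rewrite /signed_spanning -setUA (eq_reaches _ E); case: ifP => // _.
      rewrite (nullityU1 He) ?inE ?negb_or ?xD //.
      by rewrite (sub D _ _ cx) addn1 addSn exprS mulN1r addrN.
    rewrite subsetD1 => /andP[_ xD].
    have z B : rooted_acyclic R e H C B = false.
      apply/negP => /andP[/forall_inP/(_ x xH)/negP h _]; apply: h.
      have sC : subrel (connect (adj C)) (connect (step e H C B)).
        by apply: connect_sub => a b ab; apply: connect1; rewrite /step ab orbT.
      by rewrite ffunE; case: ifP => _; apply: sC; rewrite //= (connect_adj_sym C).
    by rewrite !z.
  have nH' : (#|H :\ x| < n)%N by move: nH; rewrite (cardsD1 x) xH.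
  have dH' : [disjoint H :\ x & C] by apply: disjointWl dHC; apply: subsetDl.
  have dH'' : [disjoint H :\ x & x |: C].
    by rewrite disjoint_sym disjoints_subset subUset sub1set !inE eqxx /= -disjoints_subset disjoint_sym.
  under eq_bigr => D do [rewrite subsetD1 => /andP[_ xD]; rewrite -natrD rooted_acyclic_split //; last by exists r].
  under eq_bigr => D _ do rewrite natrD.
  rewrite !big_split /= !IH //; congr (_ + _); apply: eq_bigr => B.
  rewrite subsetD1 => /andP[_ xB]; rewrite /signed_spanning setUCA -setUA.
  by rewrite (nullityU1 He xC) (negbTE cx) addn0.
have nt' x r : x \in H -> r \in R -> ~~ connect (adj C) r (e x).1 /\ ~~ connect (adj C) r (e x).2.
  move=> xH rR; apply/andP; rewrite -negb_or; apply: contra nt => h.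
  by apply/exists_inP; exists x => //; apply/exists_inP; exists r.
(* No edge of [H] touches the reached region. Either some vertex stays out of reach and both sides
   vanish, or every vertex is reached and [H] is empty. *)
have [rC|rC] := boolP (reaches R (adj C)); last first.
  rewrite !big1 // => [B sB|D _].
    rewrite /signed_spanning; case: ifP => // rB; case/negP: rC.
    apply: reaches_stuck rB => r a b rR ra /(adj_orient _ _ _ He)[y].
    rewrite inE => /orP[/(subsetP sB) yH Ey|yC Ey]; last by apply/(adj_orient _ _ _ He); exists y.
    by have [] := nt' y r yH rR; case: Ey => -> /=; rewrite ra.
  rewrite /rooted_acyclic; case: (boolP (reaches R _)) => [rD|]; last by rewrite andbF.
  case/negP: rC; apply: reaches_stuck rD => r a b rR ra /orP[/exists_inP[y yH /eqP Ey]|//].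
  have [] := nt' y r yH rR; move: Ey; rewrite ffunE.
  by case: ifP => _ E; move: ra; rewrite -[a]/(a, b).1 -E /= => ->.
have H0 : H = set0.
  apply/setP => x; rewrite [RHS]inE; apply/negP => xH.
  have [r rR rx] := reachesP _ _ rC (e x).1.
  by have [] := nt' x r xH rR; rewrite rx.
rewrite H0 (eq_bigl (pred1 set0)) ?big_pred1_eq; last by move=> D; rewrite subset0.
rewrite [RHS](eq_bigl (pred1 set0)) ?big_pred1_eq; last by move=> D; rewrite subset0.
rewrite /signed_spanning set0U rC addnn -muln2 exprM sqrr_sign.
rewrite /rooted_acyclic (_ : no_return _ _ _ = true); last by apply/forall_inP => x; rewrite inE.
rewrite (@eq_reaches _ _ _ (adj C)) ?rC //; apply: eq_connect => a b; rewrite /step.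
by case: exists_inP => [[y]|//]; rewrite inE.
Qed.
End DeletionContractionSum.

(** * Cut-equivalence in terms of potentials *)

Section CutEquivalence.
Variable G : graph.
Implicit Types (e r : arrows G) (x : edge G) (D B : {set edge G}) (S : {set vert G}).

(** The algebraic form of being empty or an oriented cut; it makes sums and differences of cuts
    available. *)
Definition is_coboundary e D : Prop :=
  exists h : vert G -> int, forall x, cobd e h x = (x \in D)%:R.

Lemma mem_cut e S x : e \in orientations G ->
  (x \in cut S) = ((e x).1 \in S) (+) ((e x).2 \in S).
Proof.
move=> He; rewrite inE -(orientationP _ He x).
case: (boolP ((e x).1 \in S)) => h1; case: (boolP ((e x).2 \in S)) => h2 /=.
- rewrite andbC (_ : _ :&: ~: S = set0) ?eqxx //; apply/setP => v; rewrite !inE.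
  by apply/negP => /andP[/orP[]/eqP ->]; rewrite ?h1 ?h2.
- by apply/andP; split; apply/set0Pn; [exists (e x).1 | exists (e x).2];
    rewrite !inE eqxx ?orbT ?h1 ?h2.
- by apply/andP; split; apply/set0Pn; [exists (e x).2 | exists (e x).1];
    rewrite !inE eqxx ?orbT ?h1 ?h2.
- rewrite (_ : _ :&: S = set0) ?eqxx //; apply/setP => v; rewrite !inE.
  by apply/negP => /andP[/orP[]/eqP ->]; rewrite ?(negbTE h1) ?(negbTE h2).
Qed.

Lemma directed_cut_coboundary e D : e \in orientations G ->
  directed_cut e D -> is_coboundary e D.
Proof.
move=> He /existsP[S /and4P[_ _ /eqP -> /orP[]/forall_inP h]].
  exists (fun v => (v \notin S)%:R) => x; rewrite /cobd (mem_cut _ _ He).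
  have := h x; rewrite (mem_cut _ _ He) !inE.
  by case: (_ \in S); case: (_ \in S) => // /(_ isT).
exists (fun v => (v \in S)%:R) => x; rewrite /cobd (mem_cut _ _ He).
have := h x; rewrite (mem_cut _ _ He) !inE.
by case: (_ \in S); case: (_ \in S) => // /(_ isT).
Qed.

(* The upper level set of a potential at the head of an edge of D is a directed
   cut inside D. *)
Lemma coboundary_bond e D x : e \in orientations G -> is_coboundary e D ->
  x \in D -> exists2 B : {set edge G}, B \subset D & directed_bond e B.
Proof.
move=> He [h hD] xD; pose S := [set v | h (e x).2 <= h v].
have eqh y : h (e y).2 = h (e y).1 + (y \in D)%:R.
  by rewrite -hD /cobd addrC subrK.
have tS : (e x).1 \notin S by rewrite inE eqh xD -ltNge; lia.
have hS : (e x).2 \in S by rewrite inE.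
have sub : cut S \subset D.
  apply/subsetP => y; rewrite (mem_cut _ _ He) !inE (eqh y).
  by case: (y \in D); rewrite // addr0 addbb.
have dir : (cut S != set0) && directed_cut e (cut S).
  apply/andP; split.
    by apply/set0Pn; exists x; rewrite (mem_cut _ _ He) hS (negbTE tS).
  apply/existsP; exists S; apply/and4P; split=> //.
  - by apply/set0Pn; exists (e x).2.
  - by apply/set0Pn; exists (e x).1; rewrite inE.
  apply/orP; right; apply/forall_inP => y yc; have yD := subsetP sub y yc.
  move: yc; rewrite (mem_cut _ _ He) !inE (eqh y) yD.
  by case: leP; case: leP => //; lia.
by have [B mB sB] := minset_exists (P := fun B => (B != set0) && directed_cut e B) dir;
  exists B; first exact: subset_trans sB sub.
Qed.

(** A directed bond inside [D] is itself a coboundary, so subtracting its potential leaves a smaller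
    coboundary, to which induction applies. *)
Lemma coboundary_partition e D : e \in orientations G -> is_coboundary e D ->
  exists P, partition P D && [forall B in P, directed_bond e B].
Proof.
move=> He; have [n] := ubnP #|D|; elim: n D => // n IH D nD cD.
have [->|/set0Pn[x xD]] := eqVneq D set0.
  exists set0; apply/andP; split; last by apply/forall_inP => B; rewrite inE.
  apply/and3P; split; rewrite ?inE //; first by rewrite /cover big_set0.
  by apply/trivIsetP => B; rewrite inE.
have [B sB bB] := coboundary_bond He cD xD.
have /andP[B0 dB] := minsetp bB.
have [hB HB] := directed_cut_coboundary He dB; have [h HD] := cD.
have cDB : is_coboundary e (D :\: B).
  exists (fun v => h v - hB v) => y; rewrite cobdB HD HB inE.
  case: (boolP (y \in B)) => yB; first by rewrite (subsetP sB y yB) subrr.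
  by rewrite subr0.
have nDB : (#|D :\: B| < n)%N.
  have /set0Pn[y yB] := B0.
  rewrite -ltnS; apply: leq_trans nD; rewrite ltnS; apply: proper_card.
  by apply/properP; split; [exact: subsetDl | exists y; rewrite ?inE ?yB // (subsetP sB)].
have [P /andP[PP bP]] := IH _ nDB cDB.
exists (B |: P); apply/andP; split; last first.
  by apply/forall_inP => C; rewrite !inE => /orP[/eqP -> //|]; move/forall_inP: bP; apply.
rewrite -[D](setID D B) (setIidPr sB); apply: partitionU1 => //.
by rewrite disjoint_sym disjoints_subset setDE subsetIr.
Qed.

Lemma sum_bonds_coboundary e D (P : {set {set edge G}}) : e \in orientations G ->
  partition P D -> (forall B, B \in P -> is_coboundary e B) -> is_coboundary e D.
Proof.
move=> He PP cP.
have /fin_all_exists[h hP] (B : {set edge G}) :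
    exists h : vert G -> int, B \in P -> forall x, cobd e h x = (x \in B)%:R.
  have [/cP[h hB]|_] := boolP (B \in P); first by exists h.
  by exists (fun=> 0).
have ind (B : {set edge G}) x : \sum_(y in B) (y == x)%:R = (x \in B)%:R :> int.
  rewrite big_mkcond (bigD1 x) //= eqxx big1 ?addr0; first by case: ifP.
  by move=> y /negbTE ->; case: ifP.
exists (fun v => \sum_(B in P) h B v) => x; rewrite /cobd -sumrB -ind.
rewrite (set_partition_big _ PP) /=; apply: eq_bigr => B BP.
by rewrite ind -(hP B BP).
Qed.

(** The potential changes by 1 on [D] and by 0 elsewhere, so the vertices of even potential form one
    side of the cut. *)
Lemma coboundary_is_cut e D : e \in orientations G -> is_coboundary e D ->
  D != set0 -> is_cut D.
Proof.
move=> He [h hD] /set0Pn[x xD]; pose S := [set v | (2 %| h v)%Z].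
have DE : D = cut S.
  apply/setP => y; rewrite (mem_cut _ _ He) !inE.
  have := hD y; rewrite /cobd; case: (y \in D); lia.
apply/existsP; exists S; rewrite DE eqxx andbT.
move: xD; rewrite DE (mem_cut _ _ He) => xS.
apply/andP; split; apply/set0Pn; case: (boolP ((e x).1 \in S)) xS => h1 /= h2.
- by exists (e x).1.
- by exists (e x).2.
- by exists (e x).2; rewrite inE.
- by exists (e x).1; rewrite inE.
Qed.

Lemma oriented_cutP e D : e \in orientations G -> D != set0 ->
  reflect (is_coboundary e D) (oriented_cut e D).
Proof.
move=> He D0; apply: (iffP andP) => [[_ /existsP[P /andP[PP /forall_inP bP]]]|cD].
  apply: (sum_bonds_coboundary He PP) => B /bP /minsetp/andP[_].
  exact: directed_cut_coboundary.
split; first exact: coboundary_is_cut cD D0.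
by have [P PP] := coboundary_partition He cD; apply/existsP; exists P.
Qed.

Lemma coboundary0 e : is_coboundary e set0.
Proof. by exists (fun=> 0) => x; rewrite /cobd inE subrr. Qed.

Lemma diff_sym e r : diff e r = diff r e.
Proof. by apply/setP => x; rewrite !inE eq_sym. Qed.

Lemma coboundary_sym e r : e \in orientations G -> r \in orientations G ->
  is_coboundary e (diff e r) -> is_coboundary r (diff r e).
Proof.
move=> He Hr [h hD]; exists (fun v => - h v) => x.
have -> : cobd r (fun v => - h v) x = - cobd r h x by rewrite /cobd opprB opprK addrC.
rewrite (cobd_orient _ _ He Hr) hD diff_sym inE eq_sym.
by case: (_ == _); rewrite ?opprK ?oppr0.
Qed.

Lemma cut_equivP e r : e \in orientations G -> r \in orientations G ->
  reflect (is_coboundary e (diff e r)) (cut_equiv e r).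
Proof.
move=> He Hr; rewrite /cut_equiv -/(diff e r).
have [->|D0] := eqVneq (diff e r) set0; first by apply: ReflectT; apply: coboundary0.
rewrite /=; apply: (iffP orP) => [[/(oriented_cutP He D0) //|/(oriented_cutP Hr D0)]|].
  by rewrite {1}diff_sym; apply: coboundary_sym.
by left; apply/oriented_cutP.
Qed.

Lemma cut_equiv_refl e : cut_equiv e e.
Proof.
rewrite /cut_equiv (_ : [set _ | _] = set0) ?eqxx //.
by apply/setP => x; rewrite !inE eqxx.
Qed.

Lemma cut_equiv_sym e r : e \in orientations G -> r \in orientations G ->
  cut_equiv e r = cut_equiv r e.
Proof.
by move=> He Hr; apply/(cut_equivP He Hr)/(cut_equivP Hr He); apply: coboundary_sym.
Qed.

(** The potentials add. On an edge reversed twice, [e] and [s] agree and the two contributions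
    cancel. *)
Lemma cut_equiv_trans e r s : e \in orientations G -> r \in orientations G ->
  s \in orientations G -> cut_equiv e r -> cut_equiv r s -> cut_equiv e s.
Proof.
move=> He Hr Hs /(cut_equivP He Hr)[h hD] /(cut_equivP Hr Hs)[k kD].
apply/(cut_equivP He Hs); exists (fun v => h v + k v) => x.
have -> : cobd e (fun v => h v + k v) x = cobd e h x + cobd e k x.
  by rewrite /cobd opprD addrACA.
move: (kD x); rewrite hD (cobd_orient k x He Hr) !inE.
case: (eqVneq (e x) (r x)) => [->|er] /=; first by rewrite add0r.
have [rs|rs] := eqVneq (r x) (s x); first by rewrite -rs er => /eqP; rewrite oppr_eq0 => /eqP ->; rewrite addr0.
have es : e x = s x.
  rewrite (orientations_eqVswap Hr Hs) 1?eq_sym //.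
  exact: (orientations_eqVswap Hr He).
by rewrite es eqxx => /eqP; rewrite eqr_oppLR => /eqP ->; rewrite subrr.
Qed.

(** Along a circuit directed by [r] the coboundary of the difference is nonnegative and sums to
    zero, so [e] and [r] agree there and [e] directs the same circuit. *)
Lemma cut_equiv_acyclic e r : e \in orientations G -> r \in orientations G ->
  cut_equiv e r -> acyclic e -> acyclic r.
Proof.
move=> He Hr; rewrite cut_equiv_sym // => /(cut_equivP Hr He)[h hD].
apply: contra => /existsP[W /existsP[F /andP[cF dF]]].
apply/existsP; exists W; apply/existsP; exists F; rewrite cF /=.
have sub : subgraph W F by case/andP: cF => /and3P[].
have eqF x : x \in F -> r x = e x.
  move=> xF; apply/eqP; have := direction_sum h sub dF.
  under eq_bigr => y _ do rewrite hD.
  rewrite (bigD1 x) //= inE; case: eqP => // _ /eqP; rewrite gt_eqF //.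
  by apply: ltr_pwDl; [|apply: sumr_ge0].
case/andP: dF => /forall_inP o /forall_inP d; apply/andP; split.
  by apply/forall_inP => x xF; rewrite -eqF // o.
apply/forall_inP => v /d /andP[/eqP d1 /eqP d2]; apply/andP; split.
  by rewrite -d1; apply/eqP/eq_card => x; rewrite !inE; case: (boolP (x \in F)) => // /eqF ->.
by rewrite -d2; apply/eqP/eq_card => x; rewrite !inE; case: (boolP (x \in F)) => // /eqF ->.
Qed.

Lemma cut_equiv_equivalence :
  {in acyclic_orientations G & &, equivalence_rel (@cut_equiv G)}.
Proof.
move=> e r s; rewrite !inE -![orients _ _](in_set (fun o => orients _ o)).
move=> /andP[He _] /andP[Hr _] /andP[Hs _]; split; first exact: cut_equiv_refl.
move=> er; apply/idP/idP; apply: cut_equiv_trans => //.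
by rewrite cut_equiv_sym.
Qed.

End CutEquivalence.

(** * One rooted orientation in each cut-equivalence class *)

Section RootedRepresentatives.
Variable G : graph.
Hypothesis Gl : loopless G.
Implicit Types (e r : arrows G) (x : edge G) (B D : {set edge G}).

Definition comp_roots : {set vert G} :=
  [set v | v \in fingraph.roots (adj [set: edge G])].

Lemma comp_rootE c v : c \in comp_roots -> connect (adj [set: edge G]) c v ->
  c = fingraph.root (adj [set: edge G]) v.
Proof.
by rewrite inE => /eqP rc /(fingraph.rootP (connect_adj_sym _)) <-.
Qed.

Lemma comp_root v : fingraph.root (adj [set: edge G]) v \in comp_roots.
Proof. by rewrite inE; apply/roots_root/connect_adj_sym. Qed.

Lemma connect_comp_root v :
  connect (adj [set: edge G]) (fingraph.root (adj [set: edge G]) v) v.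
Proof. by rewrite (connect_adj_sym _) connect_root. Qed.

Lemma arc_adj e : e \in orientations G ->
  subrel (connect (arc e)) (connect (adj [set: edge G])).
Proof.
move=> He; apply: connect_sub => u v /existsP[x /eqP Ex].
by apply/connect1/(adj_orient _ _ _ He); exists x; [rewrite inE | left].
Qed.

(* A potential of the difference of e and r is nondecreasing along the arrows of
   e and nonincreasing along those of r. *)
Lemma rooted_unique e r : e \in orientations G -> r \in orientations G ->
  reaches comp_roots (arc e) -> reaches comp_roots (arc r) ->
  cut_equiv e r -> e = r.
Proof.
move=> He Hr /reachesP Re /reachesP Rr /(cut_equivP He Hr)[h hD].
have he a b : connect (arc e) a b -> h a <= h b.
  move=> /connectP[p pP ->]; elim: p a pP => //= c p IH a /andP[/existsP[x /eqP Ex] /IH].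
  by apply: le_trans; have := hD x; rewrite /cobd Ex /=; lia.
have hr a b : connect (arc r) a b -> h b <= h a.
  move=> /connectP[p pP ->]; elim: p a pP => //= c p IH a /andP[/existsP[x /eqP Ex] /IH].
  move=> h1; apply: le_trans h1 _; have : cobd r h x <= 0.
    by rewrite (cobd_orient _ _ He Hr) hD inE; case: eqP.
  by rewrite /cobd Ex subr_le0.
(* Both [c] and [c'] are the chosen root of the component of [v], so the two monotonicities give
   opposite inequalities. *)
have hroot v : h v = h (fingraph.root (adj [set: edge G]) v).
  have [c cR cv] := Re v; have [c' cR' cv'] := Rr v.
  apply/eqP; rewrite eq_le.
  rewrite {1}(esym (comp_rootE cR' (arc_adj Hr cv'))) (esym (comp_rootE cR (arc_adj He cv))).
  by rewrite hr ?he.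
apply/ffunP => x; apply/eqP; have := hD x; rewrite /cobd (hroot (e x).1) (hroot (e x).2).
have -> : fingraph.root (adj [set: edge G]) (e x).2 = fingraph.root (adj [set: edge G]) (e x).1; last first.
  by rewrite subrr inE; case: eqP.
apply/(fingraph.rootP (connect_adj_sym [set: edge G]))/connect1/(adj_orient _ _ _ He).
by exists x; [rewrite inE | right; rewrite -surjective_pairing].
Qed.

Definition reached e : {set vert G} :=
  [set v | [exists c in comp_roots, connect (arc e) c v]].

(** A directed path from a root stays inside the reached set, so none of its edges lies in the
    reversed cut. *)
Lemma reached_flip e : e \in orientations G ->
  reached e \subset reached (flip e (cut (reached e))).
Proof.
move=> He; apply/subsetP => v; rewrite !inE => /exists_inP[c cR /connectP[p]].
elim/last_ind: p v => [|p w IH] v /=.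
  by move=> _ ->; apply/exists_inP; exists c; rewrite ?connect0.
rewrite rcons_path last_rcons => /andP[pP /existsP[x /eqP Ex]] ->.
have /exists_inP[c' cR' cl'] := IH _ pP erefl; apply/exists_inP; exists c' => //.
apply: connect_trans cl' (connect1 _); apply/existsP; exists x.
have lS : last c p \in reached e.
  by rewrite inE; apply/exists_inP; exists c => //; apply/connectP; exists p.
have wS : w \in reached e.
  rewrite inE; apply/exists_inP; exists c => //; apply/connectP; exists (rcons p w).
    by rewrite rcons_path pP; apply/existsP; exists x; apply/eqP.
  by rewrite last_rcons.
by rewrite ffunE (mem_cut _ _ He) Ex /= lS wS.
Qed.

(* If r maximizes the set reached from the roots but misses a vertex, reversing
   the cut around that set, which is directed towards it, enlarges it. *)
Lemma rooted_exists e : e \in orientations G ->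
  exists2 r, r \in orientations G & cut_equiv e r /\ reaches comp_roots (arc r).
Proof.
move=> He.
pose near r := (r \in orientations G) && cut_equiv e r.
have e0 : near e by rewrite /near He cut_equiv_refl.
case: (arg_maxnP (fun r => #|reached r|) e0) => r /andP[Hr er] rmax.
exists r => //; split=> //; set S := reached r.
have Sclosed x : (r x).1 \in S -> (r x).2 \in S.
  rewrite !inE => /exists_inP[c cR c1]; apply/exists_inP; exists c => //.
  apply: connect_trans c1 (connect1 _); apply/existsP; exists x.
  by rewrite -surjective_pairing.
suff ST v : v \in S by apply/forallP => v; have := ST v; rewrite inE.
apply/negPn/negP => vS.
have [x xc] : exists x, x \in cut S.
  apply/existsP; apply: contraNT vS => /existsPn nc.
  have sub : [set: edge G] \subset monochromatic r (fun w => w \in S).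
    apply/subsetP => x _; rewrite inE; have := nc x; rewrite (mem_cut _ _ Hr).
    by case: (_ \in S); case: (_ \in S).
  rewrite -(monochromatic_connect Hr sub (connect_comp_root v)) inE.
  by apply/exists_inP; exists (fingraph.root (adj [set: edge G]) v);
    rewrite ?comp_root ?connect0.
have cutE y : y \in cut S = ((r y).1 \notin S) && ((r y).2 \in S).
  rewrite (mem_cut _ _ Hr); have := Sclosed y.
  by case: (_ \in S); case: (_ \in S) => // ->.
have Hr' : flip r (cut S) \in orientations G by apply: flip_orientation.
have rr' : cut_equiv r (flip r (cut S)).
  apply/(cut_equivP Hr Hr'); rewrite (diff_flip Gl _ Hr).
  exists (fun w => (w \in S)%:R) => y; rewrite cutE /cobd.
  by have := Sclosed y; case: (_ \in S); case: (_ \in S) => // /(_ isT).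
have := rmax (flip r (cut S)); rewrite /near Hr' (cut_equiv_trans He Hr Hr' er rr') => /(_ isT).
apply/negP; rewrite -ltnNge; apply: proper_card; apply/properP; split.
  exact: reached_flip.
move: (xc); rewrite cutE => /andP[x1 x2]; exists (r x).1 => //.
have := subsetP (reached_flip Hr) _ x2; rewrite !inE => /exists_inP[c cR c2].
apply/exists_inP; exists c => //; apply: connect_trans c2 (connect1 _).
by apply/existsP; exists x; rewrite ffunE xc.
Qed.

Lemma mem_class e r : e \in acyclic_orientations G ->
  (r \in pblock (acyclic_classes G) e) = (r \in acyclic_orientations G) && cut_equiv e r.
Proof.
move=> eA; have pt := equivalence_partitionP (@cut_equiv_equivalence G).
have [rA|rA] := boolP (r \in acyclic_orientations G) => /=.
  exact: (pblock_equivalence_partition (@cut_equiv_equivalence G)).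
apply: contraNF rA => re.
rewrite -(cover_partition pt); apply/bigcupP; exists (pblock (acyclic_classes G) e) => //.
by apply: pblock_mem; rewrite (cover_partition pt).
Qed.

Lemma acyclic_orientationsP e :
  reflect (e \in orientations G /\ acyclic e) (e \in acyclic_orientations G).
Proof. exact: setIdP. Qed.

Lemma card_classes_rooted :
  #|acyclic_classes G| = #|[set e in acyclic_orientations G | reaches comp_roots (arc e)]|.
Proof.
have pt := equivalence_partitionP (@cut_equiv_equivalence G).
rewrite -(card_in_imset (f := pblock (acyclic_classes G))); last first.
  move=> e r; rewrite inE => /andP[eA Re]; rewrite inE => /andP[rA Rr] E.
  have /acyclic_orientationsP[He _] := eA; have /acyclic_orientationsP[Hr _] := rA.
  apply: rooted_unique => //; have := mem_class r eA; rewrite E.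
  by rewrite (mem_class _ rA) rA cut_equiv_refl /= => <-.
apply: eq_card => c; apply/idP/imsetP => [cC|[e]]; last first.
  by rewrite inE => /andP[eA _] ->; apply: pblock_mem; rewrite (cover_partition pt).
have c0 : c != set0 by apply: contraTneq cC => ->; case/and3P: pt.
have /set0Pn[e ec] := c0.
have eA : e \in acyclic_orientations G.
  by rewrite -(cover_partition pt); apply/bigcupP; exists c.
have /acyclic_orientationsP[He ae] := eA.
have [r Hr [er Rr]] := rooted_exists He.
have rA : r \in acyclic_orientations G.
  by apply/acyclic_orientationsP; split=> //; apply: (cut_equiv_acyclic He Hr er).
exists r; first by rewrite inE rA.
apply/esym/def_pblock => //; first by case/and3P: pt.
have -> : c = pblock (acyclic_classes G) e.
  by apply/esym/def_pblock => //; case/and3P: pt.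
by rewrite (mem_class _ eA) rA er.
Qed.

End RootedRepresentatives.

(** * Counting classes and weakly increasing acyclic orientations *)

Section CountingOrientations.
Variable G : graph.
Hypothesis Gl : loopless G.
Implicit Types (e r : arrows G) (x : edge G) (B D H : {set edge G}).

Lemma card_flip e (Q : pred (arrows G)) : e \in orientations G ->
  #|[set r in orientations G | Q r]| = #|[set D | Q (flip e D)]|.
Proof.
move=> He; have inj : injective (flip e).
  by apply: can_inj (diff e) _ => D; apply: diff_flip.
rewrite -(card_imset _ inj); apply: eq_card => r; apply/setIdP/imsetP.
  by case=> Hr Qr; exists (diff e r); rewrite ?inE flip_diff.
by case=> D; rewrite inE => QD ->; split; first exact: flip_orientation.
Qed.

Lemma adj0 : adj (set0 : {set edge G}) =2 fun _ _ => false.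
Proof. by move=> a b; apply/existsP => -[x]; rewrite inE. Qed.

Lemma step_arc e D : connect (step e setT set0 D) =2 connect (arc (flip e D)).
Proof.
apply: eq_connect => a b; rewrite /step adj0 orbF /arc.
by apply: eq_existsb => x; rewrite inE.
Qed.

Lemma sum_signed_spanning (R : {set vert G}) e H : e \in orientations G ->
  #|[set D : {set edge G} | (D \subset H) && rooted_acyclic R e H set0 D]|%:R =
  \sum_(B : {set edge G} | B \subset H)
    (if reaches R (adj B) then (-1) ^+ nullity B else 0) :> int.
Proof.
move=> He; have n0 : nullity (set0 : {set edge G}) = 0%N.
  by rewrite /nullity cards0 sub0n.
have d0 : [disjoint H & set0 : {set edge G}] by rewrite disjoint_sym disjoints_subset sub0set.
rewrite -sum1dep_card natr_sum big_mkcondr /=.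
rewrite -[RHS](_ : \sum_(B : {set edge G} | B \subset H) signed_spanning R set0 B = _); last first.
  by apply: eq_bigr => B _; rewrite /signed_spanning setU0 n0 addn0.
by rewrite -(sum_rooted_acyclic R He d0); apply: eq_bigr => D _; case: ifP.
Qed.

Lemma no_return_acyclic e D : e \in orientations G ->
  no_return setT (flip e D) (arc (flip e D)) = acyclic (flip e D).
Proof.
move=> He; apply/forall_inP/(acyclicP Gl (flip_orientation D He)) => h x; last by move=> _; apply: h.
by apply: h; rewrite inE.
Qed.

Lemma card_classes_sum :
  #|acyclic_classes G|%:R = \sum_(B : {set edge G})
    (if reaches (comp_roots G) (adj B) then (-1) ^+ nullity B else 0) :> int.
Proof.
have [e He] := orientation_exists G.
rewrite (card_classes_rooted Gl).
rewrite (eq_bigl (fun B => B \subset [set: edge G])); last by move=> B; rewrite subsetT.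
rewrite -(sum_signed_spanning _ _ He); congr (_ %:R).
transitivity #|[set r in orientations G | acyclic r && reaches (comp_roots G) (arc r)]|; last first.
  rewrite (card_flip _ He); apply: eq_card => D; rewrite !inE subsetT /= /rooted_acyclic.
  by rewrite (eq_no_return _ _ (step_arc e D)) (eq_reaches _ (step_arc e D)) no_return_acyclic.
apply: eq_card => r; apply/setIdP/setIdP => [[/setIdP[Hr ar] ->]|[Hr /andP[ar Rr]]].
  by rewrite ar.
by split=> //; apply/setIdP.
Qed.

Lemma reaches_ncomp B :
  reaches (comp_roots G) (adj B) = (ncomp B - ncomp [set: edge G] == 0)%N.
Proof.
have [e He] := orientation_exists G.
have sub : [set p : {ffun vert G -> bool} | [set: edge G] \subset monochromatic e p]
    \subset [set p : {ffun vert G -> bool} | B \subset monochromatic e p].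
  by apply/subsetP => p; rewrite !inE; apply: subset_trans (subsetT B).
rewrite subn_eq0 -(leq_exp2l (m := 2)) // -card_bool -!(card_monochromatic false _ He).
apply/reachesP/idP => [h|le v].
  apply/subset_leq_card/subsetP => p; rewrite !inE => mB.
  apply/subsetP => x _; rewrite inE; apply/eqP.
  have root_val v : p v = p (fingraph.root (adj [set: edge G]) v).
    have [c cR cv] := h v; rewrite -(monochromatic_connect He mB cv).
    by rewrite (comp_rootE cR (sub_adj (subsetT B) cv)).
  rewrite root_val (root_val (e x).2); congr (p _).
  apply/(fingraph.rootP (connect_adj_sym [set: edge G]))/connect1/(adj_orient _ _ _ He).
  by exists x; [rewrite inE | left; rewrite -surjective_pairing].
(* Equal cardinalities turn the inclusion [sub] into an equality. Hence the indicator of the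
   vertices that [B] joins to the root is constant on whole components of the graph. *)
have E := esym (subset_leqif_cards sub).2.
have /eqP Es := etrans E (etrans (eqn_leq _ _) (andb_true_intro (conj (subset_leq_card sub) le))).
pose c := fingraph.root (adj [set: edge G]) v.
exists c; first exact: comp_root.
pose p := [ffun w => connect (adj B) c w].
have pB : p \in [set p : {ffun vert G -> bool} | B \subset monochromatic e p].
  rewrite inE; apply/subsetP => x xB; rewrite inE !ffunE; apply/eqP.
  apply/(same_connect_r (connect_adj_sym B))/connect1/(adj_orient _ _ _ He).
  by exists x => //; left; rewrite -surjective_pairing.
move: pB; rewrite -Es inE => pE.
have := monochromatic_connect He pE (connect_comp_root v).
by rewrite !ffunE connect0.
Qed.

(** At [t = 0] only the sets [B] of full rank survive, and these are the ones that reach every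
    vertex from the roots. *)
Lemma card_classes_tutte : #|acyclic_classes G|%:R = (tutte_shift G).[0].
Proof.
rewrite -[LHS](_ : (#|acyclic_classes G|%:R : int)%:~R = _); last by rewrite natz.
rewrite card_classes_sum rmorph_sum horner_sum; apply: eq_bigr => B _ /=.
rewrite reaches_ncomp hornerZ hornerXn rk_ncomp expr0n.
by case: eqP => _ /=; rewrite ?mulr0 // mulr1 rmorphXn rmorphN1.
Qed.

Definition weakly_increasing q (e : arrows G) (p : {ffun vert G -> 'I_q}) : bool :=
  [forall x, (p (e x).1 <= p (e x).2)%N].

Lemma reachesT (s : rel (vert G)) : reaches setT s.
Proof. by apply/reachesP => v; exists v; rewrite ?inE ?connect0. Qed.

Lemma monochromatic_flip (A : eqType) e D (p : vert G -> A) :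
  monochromatic (flip e D) p = monochromatic e p.
Proof. by apply/setP => x; rewrite !inE ffunE; case: ifP => //= _; rewrite eq_sym. Qed.

(* A directed cycle can only use edges on which p is constant. *)
Lemma acyclic_weakly_increasing q e D (p : {ffun vert G -> 'I_q}) :
  e \in orientations G -> weakly_increasing (flip e D) p ->
  acyclic (flip e D) =
  no_return (monochromatic e p) (flip e D) (step e (monochromatic e p) set0 D).
Proof.
move=> He /forallP w; rewrite -no_return_acyclic //; set o := flip e D.
have inc a b : connect (arc o) a b -> (p a <= p b)%N.
  move=> /connectP[s sP ->]; elim: s a sP => //= c s IH a /andP[/existsP[x /eqP Ex] /IH].
  by apply: leq_trans; have := w x; rewrite -/o Ex.
have lift a b : connect (arc o) a b -> (p b <= p a)%N ->
    connect (step e (monochromatic e p) set0 D) a b.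
  move=> /connectP[s sP ->]; elim: s a sP => [|c s IH] a /=; first by rewrite connect0.
  move=> /andP[ac sP] ba; have cb : (p c <= p (last c s))%N.
    by apply: inc; apply/connectP; exists s.
  have ac' : (p a <= p c)%N by apply/inc/connect1.
  apply: connect_trans (IH _ sP (leq_trans ba ac')); apply: connect1.
  rewrite /step adj0 orbF; have /existsP[x Ex] := ac.
  apply/exists_inP; exists x => //; rewrite -(monochromatic_flip e D) inE -/o (eqP Ex) /=.
  by rewrite -val_eqE /= eqn_leq ac' (leq_trans cb ba).
apply/forall_inP/forall_inP => h x xH.
  apply: contra (h x (in_setT _)); apply: connect_sub => a b /orP[|]; last by rewrite adj0.
  by case/exists_inP=> y _ Ey; apply/connect1/existsP; exists y.
have [xm|xm] := boolP (x \in monochromatic e p).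
  apply: contra (h x xm) => /lift; apply.
  by move: xm; rewrite -(monochromatic_flip e D) inE => /eqP ->.
apply: contra xm => /inc h1; have h2 := w x.
by rewrite -(monochromatic_flip e D) inE -val_eqE /= eqn_leq h1 h2.
Qed.

Lemma card_weakly_increasing q e (p : {ffun vert G -> 'I_q}) : e \in orientations G ->
  #|[set r in orientations G | acyclic r && weakly_increasing r p]|%:R =
  \sum_(B : {set edge G} | B \subset monochromatic e p) (-1) ^+ nullity B :> int.
Proof.
(* Once all edges point uphill for [p], the weakly increasing orientations are exactly the reversals
   of sets of edges on which [p] is constant. *)
move=> He; pose e1 := flip e [set x | (p (e x).2 < p (e x).1)%N].
have He1 : e1 \in orientations G by apply: flip_orientation.
have w1 x : (p (e1 x).1 <= p (e1 x).2)%N.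
  by rewrite ffunE inE; case: ltnP => //= /ltnW.
have <- : monochromatic e1 p = monochromatic e p by apply: monochromatic_flip.
have wE D : weakly_increasing (flip e1 D) p = (D \subset monochromatic e1 p).
  apply/forallP/subsetP => [h x xD|h x].
    by have := h x; rewrite !inE ffunE xD /= -val_eqE /= eqn_leq w1.
  rewrite ffunE; case: ifP => [/h|_]; last exact: w1.
  by rewrite inE /= => /eqP ->.
rewrite (card_flip _ He1).
transitivity (\sum_(B : {set edge G} | B \subset monochromatic e1 p)
    (if reaches setT (adj B) then (-1) ^+ nullity B else 0) : int); last first.
  by apply: eq_bigr => B _; rewrite reachesT.
rewrite -(sum_signed_spanning _ _ He1); congr (_ %:R); apply: eq_card => D.
rewrite !inE -wE; case: (boolP (weakly_increasing _ _)) => wD; last by rewrite andbF.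
by rewrite andbT /rooted_acyclic reachesT andbT (acyclic_weakly_increasing He1 wD).
Qed.

(** After exchanging the sums, each [B] is counted once for every colouring that is monochromatic on
    it. *)
Lemma sum_weakly_increasing q : (0 < q)%N ->
  (\sum_(p : {ffun vert G -> 'I_q})
    #|[set r in orientations G | acyclic r && weakly_increasing r p]|)%:R =
  \sum_(B : {set edge G}) (-1) ^+ nullity B * (q ^ ncomp B)%:R :> int.
Proof.
case: q => // q _; have [e He] := orientation_exists G.
rewrite natr_sum; under eq_bigr => p _ do rewrite (card_weakly_increasing _ He).
rewrite (exchange_big_dep predT) //=; apply: eq_bigr => B _.
rewrite sumr_const mulr_natr; congr (_ *+ _).
rewrite -[X in _ = (X ^ _)%N](card_ord q.+1) -(card_monochromatic ord0 B He).
by apply: eq_card => p; rewrite !inE.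
Qed.

End CountingOrientations.

(** * Bounded integer tensions and their reduction modulo q *)

Lemma Zp_sub_eq_inZp q (a b : 'I_q.+1) (n : nat) :
  (a - b == inZp n) = (q.+1 %| (n%:Z - ((a : nat)%:Z - (b : nat)%:Z)))%Z.
Proof.
rewrite subr_eq -val_eqE /= modnDml.
rewrite -{1}(modn_small (ltn_ord a)) -(eqz_nat (_ %% _)%N) -!modz_nat eqz_mod_dvd.
rewrite -rpredN (_ : - (a%:Z - (n + b)%:Z) = n%:Z - (a%:Z - b%:Z)) //; lia.
Qed.

Lemma Zp1_mulrn q n : (Zp1 : 'I_q.+1) *+ n = inZp n.
Proof. by apply: val_inj; rewrite Zp_mulrn /= modnMml mul1n. Qed.

Lemma addr_mulb_neq q (d : int) (b : bool) : (d + q.+1%:Z * b%:R != d) = b.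
Proof. by rewrite -subr_eq0 addrAC subrr add0r; case: b; rewrite ?mulr0 ?mulr1. Qed.

Section BoundedTensions.
Variables (G : graph) (rep : {set arrows G} -> arrows G) (q : nat).
Hypothesis Gl : loopless G.
Hypothesis repP : forall c, c \in acyclic_classes G -> rep c \in c.
Implicit Types (e r : arrows G) (x : edge G) (p : {ffun vert G -> 'I_q.+1}).
Implicit Type f : {ffun edge G -> 'I_q.+2}.

(** Residues are modulo [q.+1] while [f] takes values from 0 to [q.+1], so the residue 0 has two
    lifts, 0 and [q.+1]. *)
Definition congruent p r f : bool := [forall x, cobd r p x == inZp (f x)].

(** An integer potential of [f], reduced modulo [q.+1], is one solution; [card_potentials] then
    counts them all. *)
Lemma card_congruent r f : r \in orientations G ->
  is_tension r (fun x => (f x : nat)%:Z) ->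
  #|[set p | congruent p r f]| = (q.+1 ^ ncomp [set: edge G])%N.
Proof.
move=> Hr /(tensionP Gl _ Hr)[P fP].
rewrite -[X in (X ^ _)%N](card_ord q.+1).
apply: (card_potentials (f := fun x => inZp (f x)) (p0 := fun v => Zp1 *~ P v)) => // x.
by rewrite /cobd -mulrzBr -/(cobd r P x) -fP -Zp1_mulrn.
Qed.

(** The difference of the values of [p] lies between [-q] and [q], and [f x] between 0 and [q.+1],
    so their gap is a multiple [k * q.+1] with [k] equal to 0 or 1. *)
Lemma congruentP p r f x : congruent p r f ->
  exists2 b : bool, (f x : nat)%:Z =
    (p (r x).2 : nat)%:Z - (p (r x).1 : nat)%:Z + q.+1%:Z * b%:R &
    (b = false -> (p (r x).1 <= p (r x).2)%N) /\ (b = true -> (p (r x).2 <= p (r x).1)%N).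
Proof.
move=> /forallP/(_ x); rewrite Zp_sub_eq_inZp => /dvdzP[k].
have := ltn_ord (f x); have := ltn_ord (p (r x).1); have := ltn_ord (p (r x).2).
move: (p _ : nat) (p _ : nat) (f x : nat) => a b n ha hb hn E.
have [k0|k1] : (k = 0 :> int) \/ (k = 1 :> int) by nia.
  by exists false; [|split=> //]; rewrite ?mulr0; lia.
by exists true; [|split=> //]; rewrite ?mulr1; lia.
Qed.

Lemma class_rep e : e \in acyclic_orientations G ->
  let r := rep (pblock (acyclic_classes G) e) in
  [/\ pblock (acyclic_classes G) e \in acyclic_classes G,
      r \in acyclic_orientations G & cut_equiv e r].
Proof.
move=> eA; have pt := equivalence_partitionP (@cut_equiv_equivalence G).
have cC : pblock (acyclic_classes G) e \in acyclic_classes G.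
  by apply: pblock_mem; rewrite (cover_partition pt).
by have := repP cC; rewrite mem_class // => /andP[rA er].
Qed.

Lemma rep_class c : c \in acyclic_classes G ->
  rep c \in acyclic_orientations G /\ pblock (acyclic_classes G) (rep c) = c.
Proof.
move=> cC; have pt := equivalence_partitionP (@cut_equiv_equivalence G).
split; last by apply: def_pblock (repP cC) => //; case/and3P: pt.
by rewrite -(cover_partition pt); apply/bigcupP; exists c => //; apply: repP.
Qed.

(** Along a weakly increasing [e] the difference [d] is exact. Where [r] disagrees with [e], the
    coboundary along [r] is [-d], and adding [q.+1] brings it into range. *)
Definition lift_tension p e r : {ffun edge G -> 'I_q.+2} :=
  [ffun x => let d := (p (e x).2 - p (e x).1)%N in
             inord (if e x == r x then d else q.+1 - d)%N].

Lemma lift_tensionE p e r x : e \in orientations G -> r \in orientations G ->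
  weakly_increasing e p ->
  (lift_tension p e r x : nat)%:Z =
  (p (r x).2 : nat)%:Z - (p (r x).1 : nat)%:Z + q.+1%:Z * (e x != r x)%:R.
Proof.
move=> He Hr /forallP/(_ x) w; rewrite ffunE.
have h2 := ltn_ord (p (e x).2).
rewrite inordK; last by case: ifP => _; lia.
case: eqVneq => [<-|er]; first by lia.
have -> : r x = swap (e x) by apply: orientations_eqVswap; rewrite // eq_sym.
by rewrite /=; lia.
Qed.

(* With r the representative of the class of e, the pair (p, e) corresponds to
   the tension f = cobd r p + q [e <> r]; conversely f and p determine the edges
   on which e and r differ. *)
Lemma card_tension_triples :
  #|[set y : {ffun vert G -> 'I_q.+1} * ({set arrows G} * {ffun edge G -> 'I_q.+2}) |
      (y.2 \in bounded_tensions rep q.+1) && congruent y.1 (rep y.2.1) y.2.2]| =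
  #|[set z : {ffun vert G -> 'I_q.+1} * arrows G |
      (z.2 \in acyclic_orientations G) && weakly_increasing z.2 z.1]|.
Proof.
pose Phi (z : {ffun vert G -> 'I_q.+1} * arrows G) :=
  let c := pblock (acyclic_classes G) z.2 in (z.1, (c, lift_tension z.1 z.2 (rep c))).
rewrite -[RHS](card_in_imset (f := Phi)); last first.
  move=> [p e] [p' e']; rewrite in_set => /andP[/= eA w]; rewrite in_set => /andP[/= eA' w'].
  rewrite /Phi /= => -[pE cE]; rewrite -{}cE -{p'}pE in w' * => lE.
  have [_ rA _] := class_rep eA; have /acyclic_orientationsP[Hr _] := rA.
  have /acyclic_orientationsP[He _] := eA; have /acyclic_orientationsP[He' _] := eA'.
  congr (_, _); rewrite -(flip_diff Hr He) -(flip_diff Hr He'); congr (flip _ _).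
  rewrite !(diff_sym (rep _)); apply/setP => x; rewrite !inE.
  have := lift_tensionE x He Hr w; rewrite lE (lift_tensionE x He' Hr w') => /addrI.
  by do 2!case: (_ != _); rewrite ?mulr0 ?mulr1.
apply: eq_card => -[p [c f]]; apply/idP/imsetP => [|[[p' e]]].
  rewrite !inE /= => /andP[/andP[cC ft] cong].
  have [rA cE] := rep_class cC; set r := rep c in ft cong rA cE.
  have /acyclic_orientationsP[Hr ar] := rA.
  (* On these edges [f] exceeds the coboundary of [p] by [q.+1]; reversing them in [r] recovers the
     orientation [e]. *)
  pose D := [set x | (f x : nat)%:Z != (p (r x).2 : nat)%:Z - (p (r x).1 : nat)%:Z].
  have fE x : (f x : nat)%:Z =
      (p (r x).2 : nat)%:Z - (p (r x).1 : nat)%:Z + q.+1%:Z * (x \in D)%:R.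
    rewrite inE; have [b -> _] := congruentP x cong.
    by rewrite addr_mulb_neq.
  have [P fP] := tensionP Gl _ Hr ft.
  pose e := flip r D; have He : e \in orientations G by apply: flip_orientation.
  have re : cut_equiv r e.
    (* Along an arrow of [r], [P - p] changes by [q.+1] on [D] and by 0 elsewhere, so its floor
       quotient by [q.+1] is an integer potential of the indicator of [D]. *)
    apply/(cut_equivP Hr He); exists (fun v => (P v - (p v : nat)%:Z) %/ q.+1)%Z => x.
    rewrite (diff_flip Gl _ Hr) /cobd.
    have -> : P (r x).2 - (p (r x).2 : nat)%:Z =
        (x \in D)%:R * q.+1%:Z + (P (r x).1 - (p (r x).1 : nat)%:Z).
      by have := fP x; rewrite fE /cobd; lia.
    by rewrite divzMDl // addrK.
  have eA : e \in acyclic_orientations G.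
    by apply/acyclic_orientationsP; split=> //; apply: cut_equiv_acyclic re ar.
  have w : weakly_increasing e p.
    apply/forallP => x; rewrite ffunE inE.
    have [b -> [b0 b1]] := congruentP x cong.
    by rewrite addr_mulb_neq; case: b b0 b1 => [_ -> | ->].
  have ce : pblock (acyclic_classes G) e = c.
    apply: def_pblock => //; first by case/and3P: (equivalence_partitionP (@cut_equiv_equivalence G)).
    by rewrite -cE mem_class // eA re.
  exists (p, e); first by rewrite in_set eA w.
  rewrite /Phi /= ce; congr (_, (_, _)); apply/ffunP => x; apply/val_inj/eqP.
  rewrite -eqz_nat lift_tensionE // fE -/r; apply/eqP; congr (_ + _ * _%:R).
  by rewrite -{1}(diff_flip Gl D Hr) inE eq_sym.
rewrite in_set => /andP[/= eA w] [-> -> ->]; rewrite !inE /=.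
have [cC rA er] := class_rep eA; rewrite cC /=; set r := rep _ in rA er *.
have /acyclic_orientationsP[He _] := eA; have /acyclic_orientationsP[Hr _] := rA.
apply/andP; split; last first.
  apply/forallP => x; rewrite Zp_sub_eq_inZp lift_tensionE //.
  by rewrite addrAC subrr add0r dvdz_mulr.
move: er; rewrite cut_equiv_sym // => /(cut_equivP Hr He)[h hD].
(* The lifted tension has a potential: [p'] plus [q.+1] times a potential of the edges where [r] and
   [e] differ. *)
apply: (@cobd_tension _ _ _ _ (fun v => (p' v : nat)%:Z + q.+1%:Z * h v)) => // x.
rewrite lift_tensionE // eq_sym; have := hD x; rewrite inE => <-.
by rewrite /cobd mulrBr opprD addrACA.
Qed.

(** Double counting: each bounded tension has [q.+1 ^ k(G)] congruent potentials, while the same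
    triples, sorted by [p], are the weakly increasing acyclic orientations. *)
Lemma card_bounded_tensions :
  (#|bounded_tensions rep q.+1| * q.+1 ^ ncomp [set: edge G])%N =
  (\sum_(p : {ffun vert G -> 'I_q.+1})
    #|[set r in orientations G | acyclic r && weakly_increasing r p]|)%N.
Proof.
transitivity #|[set z : {ffun vert G -> 'I_q.+1} * arrows G |
      (z.2 \in acyclic_orientations G) && weakly_increasing z.2 z.1]|; last first.
  rewrite -sum1dep_card.
  rewrite -(pair_big_dep predT (fun p e => (e \in acyclic_orientations G) && weakly_increasing e p) (fun _ _ => 1%N)) /=.
  apply: eq_bigr => p _; rewrite sum1dep_card; apply: eq_card => e.
  by rewrite !inE andbA.
rewrite -card_tension_triples -[RHS]sum1dep_card.
rewrite -(pair_big_dep predT (fun p cf => (cf \in bounded_tensions rep q.+1) && congruent p (rep cf.1) cf.2) (fun _ _ => 1%N)) /=.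
rewrite (exchange_big_dep (mem (bounded_tensions rep q.+1))) /=; last by move=> p cf _ /andP[].
rewrite -sum_nat_const; apply: eq_bigr => -[c f]; rewrite inE => /andP[/= cC ft].
have [/acyclic_orientationsP[Hr _] _] := rep_class cC.
rewrite -(card_congruent Hr ft) -sum1dep_card; apply: eq_bigl => p.
by rewrite cC ft.
Qed.

End BoundedTensions.

(** * Identification of bar-tau and conclusion *)

Lemma is_taubar_poly_tutte (G : graph) : loopless G -> is_taubar_poly G (tutte_shift G).
Proof.
move=> Gl rep repP [//|q] _.
have q0 : q.+1%:R != 0 :> rat by rewrite pnatr_eq0.
apply: (mulIf (expf_neq0 (ncomp [set: edge G]) q0)).
rewrite horner_ncomp -natrX -natrM (card_bounded_tensions q Gl repP).
set m := (\sum_(p : {ffun _}) _)%N.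
have -> : m%:R = (m%:R : int)%:~R :> rat by rewrite natz.
rewrite (sum_weakly_increasing Gl (ltn0Sn q)) rmorph_sum; apply: eq_bigr => B _ /=.
rewrite -natrX; set n := (_ ^ _)%N; have -> : n%:R = (n%:R : int)%:~R :> rat by rewrite natz.
by rewrite rmorphM rmorphXn rmorphN1.
Qed.

Lemma taubar_eq (G : graph) : loopless G -> taubar G = tutte_shift G.
Proof.
move=> Gl; have H := is_taubar_poly_tutte Gl.
have H' : is_taubar_poly G (taubar G).
  by apply: (@ClassicalEpsilon.epsilon_spec _ (inhabits 0) (is_taubar_poly G)); exists (tutte_shift G).
have [e0 _] := orientation_exists G.
(* Comparing the two polynomials takes an actual system of representatives; the pick succeeds on
   every class because classes are nonempty. *)
pose rep (c : {set arrows G}) := odflt e0 [pick e in c].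
have repP c : c \in acyclic_classes G -> rep c \in c.
  move=> cC; rewrite /rep; case: pickP => //= c0.
  have /and3P[_ _ /negP[]] := equivalence_partitionP (@cut_equiv_equivalence G).
  by rewrite (_ : set0 = c) //; apply/setP => e; rewrite c0 inE.
apply: (@poly_eqP_nat _ _ 1) => n n0.
by rewrite (H rep repP) // (H' rep repP).
Qed.

Theorem corollary1p4 (G : graph) (Gloopless : loopless G) :
  [/\ map_poly (horner_eval 0) (tutte G) = taubar G \Po ('X - 1),
      taubar G \Po ('X - 1) = (-1) ^+ rkG G *: (tau G \Po (1 - 'X)),
      (tutte G).[1, 0] = (-1) ^+ rkG G * (tau G).[0],
      (-1) ^+ rkG G * (tau G).[0] = (taubar G).[0]
    & (taubar G).[0] = #|acyclic_classes G|%:R].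
Proof.
rewrite (taubar_eq Gloopless) (tau_eq Gloopless).
have tau0 : (-1) ^+ rkG G * (tau_expansion G).[0] = (tutte_shift G).[0].
  (* At [t = 1] both substitutions, [1 - t] and [t - 1], evaluate to 0. *)
  have := congr1 (fun P => P.[1]) (tau_tutte G).
  by rewrite hornerZ !horner_comp !hornerE subrr.
split=> //.
- exact: tutte_y0.
- by rewrite tau_tutte.
- by rewrite tutte_10 tau0.
- by rewrite card_classes_tutte.
Qed.
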